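(* Let $\Omega\subset\mathbb{C}$ be a Jordan domain (the bounded complementary component of a Jordan curve) and let $\phi:\overline{D}\to\overline{\Omega}$ be a Riemann mapping, i.e. a homeomorphism of $\overline{D}$ onto $\overline{\Omega}$ mapping $D$ conformally onto $\Omega$. Let $A(\Omega)$ be the space of functions continuous on $\overline{\Omega}$ and holomorphic on $\Omega$, with the topology of uniform convergence on $\overline{\Omega}$. Then the set of functions $f\in A(\Omega)$ such that $(f\circ\phi)\restriction_{\mathbb{T}}\in Z$ is a dense $G_\delta$ subset of $A(\Omega)$.
   Context: $D$ is the open unit disc and $\mathbb{T}=\partial D$. A function $g$ on $\mathbb{T}$ is identified with the $2\pi$-periodic function $y\mapsto g(e^{iy})$ on $\mathbb{R}$, written $g(y)$. The class $Z$ consists of all continuous $f:\mathbb{T}\to\mathbb{C}$ such that for every $\theta\in\mathbb{R}$ $$\limsup_{y\to\theta^+}\left|\frac{\operatorname{Re}f(y)-\operatorname{Re}f(\theta)}{y-\theta}\right|=+\infty\quad\text{and}\quad \limsup_{y\to\theta^+}\left|\frac{\operatorname{Im}f(y)-\operatorname{Im}f(\theta)}{y-\theta}\right|=+\infty.$$ *)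

(* Defs.v *)
(* The complex plane is R[i] (mathcomp-real-closed
   complex numbers over a realType R), viewed through the regular-algebra
   alias ^o so that it is a normed module over itself: its topology is the
   usual metric topology given by the modulus, and [derivable f z 1] is
   complex differentiability of f at z. *)
From mathcomp Require Import all_boot all_order all_algebra.
From mathcomp Require Import all_classical all_reals all_analysis.
From mathcomp Require Import complex.
Import numFieldNormedType.Exports.
Import Order.TTheory GRing.Theory Num.Theory.

Set Implicit Arguments.
Unset Strict Implicit.
Unset Printing Implicit Defensive.

Local Open Scope ring_scope.
Local Open Scope classical_set_scope.

Definition Cplx (R : realType) := (R[i])^o.

Section Defs.
Variable R : realType.
Local Notation C := (Cplx R).

Definition unit_circle : set C := [set z | `|z| = 1].
Definition open_disc : set C := [set z | `|z| < 1].
Definition closed_disc : set C := [set z | `|z| <= 1].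

Definition expi (y : R) : C := Complex (cos y) (sin y).

Definition holomorphic_on (f : C -> C) (U : set C) : Prop :=
  forall z, U z -> derivable f z 1.

(* Jordan curve: a homeomorphic image of the unit circle T
   (a continuous injective map from the compact set T). *)
Definition jordan_curve (G : set C) : Prop :=
  exists gam : C -> C,
    {within unit_circle, continuous gam} /\
    (forall x y, unit_circle x -> unit_circle y -> gam x = gam y -> x = y) /\
    G = gam @` unit_circle.

Definition jordan_domain (Om : set C) : Prop :=
  exists G : set C, jordan_curve G /\
    exists x : C, ~ G x /\ Om = connected_component (~` G) x /\ bounded_set Om.

Definition riemann_mapping (Om : set C) (phi : C -> C) : Prop :=
  {within closed_disc, continuous phi} /\
  (exists psi : C -> C,
      {within closure Om, continuous psi} /\
      (forall z, closed_disc z -> closure Om (phi z) /\ psi (phi z) = z) /\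
      (forall w, closure Om w -> closed_disc (psi w) /\ phi (psi w) = w)) /\
  phi @` open_disc = Om /\
  holomorphic_on phi open_disc.

Definition disc_algebra (Om : set C) : set (C -> C) :=
  [set f | {within closure Om, continuous f} /\ holomorphic_on f Om].

Definition unif_close (Om : set C) (f g : C -> C) (e : R) : Prop :=
  forall z, closure Om z -> `|f z - g z| < (e%:C)%C.

Definition open_in_A (Om : set C) (U : set (C -> C)) : Prop :=
  forall f, disc_algebra Om f -> U f ->
    exists2 e : R, 0 < e &
      forall g, disc_algebra Om g -> unif_close Om f g e -> U g.

Definition Gdelta_in_A (Om : set C) (S : set (C -> C)) : Prop :=
  S `<=` disc_algebra Om /\
  exists U : nat -> set (C -> C),
    (forall n, open_in_A Om (U n)) /\
    S = disc_algebra Om `&` \bigcap_n U n.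

Definition dense_in_A (Om : set C) (S : set (C -> C)) : Prop :=
  S `<=` disc_algebra Om /\
  forall f, disc_algebra Om f -> forall e : R, 0 < e ->
    exists2 g, S g & unif_close Om f g e.

Definition infinite_right_upper_dini (u : R -> R) (theta : R) : Prop :=
  forall M : R, forall d : R, 0 < d ->
    exists y : R, theta < y < theta + d /\
      M < `|(u y - u theta) / (y - theta)|.

Definition classZ (g : C -> C) : Prop :=
  {within unit_circle, continuous g} /\
  forall theta : R,
    infinite_right_upper_dini (fun y => complex.Re (g (expi y))) theta /\
    infinite_right_upper_dini (fun y => complex.Im (g (expi y))) theta.

End Defs.

(* Main.v *)
Require Import Defs.
From mathcomp Require Import all_boot all_order all_algebra.
From mathcomp Require Import all_classical all_reals all_analysis.
From mathcomp Require Import complex ring lra.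
Import numFieldNormedType.Exports.
Import Order.TTheory GRing.Theory Num.Theory.
Set Implicit Arguments.
Unset Strict Implicit.
Unset Printing Implicit Defensive.
Local Open Scope ring_scope.
Local Open Scope classical_set_scope.

(** A perturbation [f + c psi^n], with [psi] the inverse of the Riemann mapping,
    makes the boundary function steep at every point: by uniform continuity the
    oscillation of [f o phi] at scale [1/n] is negligible against that of
    [c e^(i n y)], whose slopes are of order [c n].  Hence the sets "at every
    theta some difference quotient over (0, 1/k) exceeds k", which are open by
    compactness of the circle, are dense, and a Baire argument concludes.

    This needs [psi] to be holomorphic and uniform limits of holomorphic
    functions to be holomorphic.  Both follow from one inequality: for [g]
    holomorphic on a punctured disc, the modulus of the limit of [g] at the
    center is at most the maximum of [|g|] on a circle.  It is Goursat's lemma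
    for [g (c + exp z)] on a rectangle of height 2 pi, whose horizontal sides
    cancel by periodicity.  Applied to [(z - p)^2 g^n] with n to infinity, it
    tolerates a further exceptional point [p] near which [g] is bounded; applied
    to difference quotients it gives Cauchy estimates.  If [phi' z0 = 0], these
    show that [z0] is an isolated critical point, so [psi] is holomorphic off
    [phi z0], hence Lipschitz there, contradicting [phi' z0 = 0]. *)

(** The perturbation is a power of [psi] because [psi ^+ n] pulls back under [phi] to exp(i n y) on
    the circle and has modulus at most 1 on the closure of [Om], so [c] alone bounds its size; it
    lies in the algebra only if [psi] is holomorphic. The derivatives of cos(n y) and sin(n y)
    vanish at some angles, so the step that exhibits a large slope must depend on the point: a
    quarter or a half turn of n y always changes the chosen coordinate by at least 1/4.

    The complex analysis uses neither contour integrals nor power series. Exponential coordinates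
    turn circles into vertical segments, so only primitives of real functions of one variable occur,
    and the mean value theorem replaces averages over circles by values at intermediate points. The
    order of a zero, usually read off a power series, is here the largest k for which f / (z - p)^k
    stays bounded near p. *)

Section Modulus.
Variable R : realType.
Local Notation C := (Cplx R).
Implicit Types z w : C.

(** [|z|] is an element of the complex field, whose order is only partial. The same number taken in
    [R] makes real order lemmas and [lra] available. *)
Definition nm (z : C) : R := complex.Re `|z|.

Lemma nmE z : `|z| = ((nm z)%:C)%C :> R[i].
Proof. by rewrite /nm normc_def. Qed.

Lemma nm_sqrt z : nm z = Num.sqrt (complex.Re z ^+ 2 + complex.Im z ^+ 2).
Proof. by rewrite /nm normc_def. Qed.

Lemma normC_lt z (e : R) : (`|z| < (e%:C)%C) = (nm z < e).
Proof. by rewrite nmE ltcR. Qed.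

Lemma nm_ge0 z : 0 <= nm z.
Proof. by rewrite nm_sqrt sqrtr_ge0. Qed.

Lemma nm0 : nm 0 = 0.
Proof. by rewrite /nm normr0. Qed.

Lemma nm1 : nm 1 = 1.
Proof. by rewrite /nm normr1. Qed.

Lemma nmM z w : nm (z * w) = nm z * nm w.
Proof.
by apply: (@complexI R); rewrite rmorphM /= -!nmE normrM.
Qed.

Lemma nmX z n : nm (z ^+ n) = nm z ^+ n.
Proof. by elim: n => [|n IH]; rewrite ?expr0 ?nm1 // !exprS nmM IH. Qed.

Lemma nmN z : nm (- z) = nm z.
Proof. by rewrite /nm normrN. Qed.

Lemma nm_distC z w : nm (z - w) = nm (w - z).
Proof. by rewrite -nmN opprB. Qed.

Lemma nmD z w : nm (z + w) <= nm z + nm w.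
Proof.
have := ler_normD z w; rewrite !nmE -lecR rmorphD /=.
by [].
Qed.

Lemma nmB z w : nm (z - w) <= nm z + nm w.
Proof. by rewrite -(nmN w); exact: nmD. Qed.

Lemma nm_triangle (y z w : C) : nm (z - w) <= nm (z - y) + nm (y - w).
Proof.
have -> : z - w = (z - y) + (y - w) by ring.
exact: nmD.
Qed.

Lemma nm_subr_ge z w : nm z - nm w <= nm (z - w).
Proof. by rewrite lerBlDr -{1}(subrK w z) nmD. Qed.

Lemma nm_eq0 z : (nm z == 0) = (z == 0).
Proof.
rewrite -(normr_eq0 z) nmE; apply/eqP/eqP => [->//|].
by move/(@complexI R).
Qed.

Lemma nm_gt0 z : (0 < nm z) = (z != 0).
Proof. by rewrite lt_neqAle nm_ge0 andbT eq_sym nm_eq0. Qed.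

Lemma nmV z : nm z^-1 = (nm z)^-1.
Proof.
apply: (@complexI R); rewrite fmorphV /= -!nmE; exact: normfV.
Qed.

Lemma nm_real (x : R) : nm (x%:C)%C = `|x|.
Proof. by rewrite nm_sqrt /= expr0n /= addr0 sqrtr_sqr. Qed.

Lemma nm_Re z : `|complex.Re z| <= nm z.
Proof. by rewrite nm_sqrt -sqrtr_sqr ler_wsqrtr // lerDl sqr_ge0. Qed.

Lemma nm_Im z : `|complex.Im z| <= nm z.
Proof. by rewrite nm_sqrt -sqrtr_sqr ler_wsqrtr // lerDr sqr_ge0. Qed.

Lemma nm_le_ReIm z : nm z <= `|complex.Re z| + `|complex.Im z|.
Proof.
rewrite nm_sqrt -[leRHS]ger0_norm ?addr_ge0 // -sqrtr_sqr ler_wsqrtr //.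
rewrite sqrrD !real_normK ?num_real //.
by rewrite addrAC lerDl mulrn_wge0 // mulr_ge0.
Qed.

Lemma ReB z w : complex.Re (z - w) = complex.Re z - complex.Re w.
Proof. by case: z => a b; case: w. Qed.

Lemma ImB z w : complex.Im (z - w) = complex.Im z - complex.Im w.
Proof. by case: z => a b; case: w. Qed.

(** * Continuity expressed with the real modulus *)

Lemma nbhs_nmP z (P : set C) :
  nbhs z P <-> exists2 e : R, 0 < e & forall w, nm (w - z) < e -> P w.
Proof.
split=> [/nbhs_normP [e /= e0 eP]|[e e0 eP]].
  have eE : e = ((complex.Re e)%:C)%C.
    by rewrite RRe_real // gtr0_real.
  exists (complex.Re e); first by rewrite -ltcR -eE.
  by move=> w zw; apply: eP => /=; rewrite eE normC_lt nm_distC.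
apply/(@nbhs_normP _ C z P); exists ((e%:C)%C); first by rewrite /= ltcR.
by move=> w /=; rewrite normC_lt nm_distC => /eP.
Qed.

Lemma within_continuous_nmP (A : set C) (f : C -> C) :
  {within A, continuous f} <->
  forall z, A z -> forall e : R, 0 < e -> exists2 d : R, 0 < d &
    forall w, A w -> nm (w - z) < d -> nm (f w - f z) < e.
Proof.
split=> [/subspace_continuousP cf z Az e e0|cf].
  have /cf fz := Az.
  have /fz : nbhs (f z) [set y | nm (y - f z) < e].
    by apply/nbhs_nmP; exists e.
  rewrite nbhs_simpl /= => /nbhs_nmP [d d0 dP].
  by exists d => // w Aw /dP /(_ Aw).
apply/subspace_continuousP => z Az P /nbhs_nmP [e e0 eP].
have [d d0 dP] := cf z Az e e0.
by apply/nbhs_nmP; exists d => // w zw Aw; apply: eP; apply: dP.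
Qed.

Lemma within_continuous_ReIm (A : set R) (f : R -> C) :
  (forall x, A x -> forall e : R, 0 < e -> exists2 d : R, 0 < d &
    forall y, A y -> `|y - x| < d -> nm (f y - f x) < e) ->
  {within A, continuous (fun x => complex.Re (f x))} /\
  {within A, continuous (fun x => complex.Im (f x))}.
Proof.
move=> cf; split; apply/subspace_continuousP => x Ax;
  apply/cvgrPdist_lt => e e0; have [d d0 dP] := cf x Ax e e0;
  apply/nbhs_normP; exists d => //= y /=; rewrite distrC => xy Ay;
  rewrite distrC; apply: le_lt_trans (dP y Ay xy).
- by rewrite -ReB nm_Re.
- by rewrite -ImB nm_Im.
Qed.

(** * Complex derivatives *)

(** The multiplied-out form of the derivative: nothing is divided by [w - z], the point [w = z]
    needs no exclusion, and the value [l] stays available for estimates. *)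
Definition cderiv (f : C -> C) (z l : C) := forall e : R, 0 < e ->
  exists2 d : R, 0 < d & forall w, nm (w - z) < d ->
    nm (f w - f z - l * (w - z)) <= e * nm (w - z).

Lemma cderivP f z : derivable f z 1 <-> exists l, cderiv f z l.
Proof.
split=> [/cvg_ex [l fl]|[l fl]].
  exists l => e e0.
  have /fl : nbhs (l : C) [set y | nm (y - l) < e].
    by apply/nbhs_nmP; exists e.
  rewrite nbhs_simpl /= => /nbhs_nmP [d d0 dP].
  exists d => // w zw.
  have [->|wz] := eqVneq w z; first by rewrite !subrr mulr0 subrr nm0 mulr0.
  have wz0 : w - z != 0 by rewrite subr_eq0.
  have := dP (w - z); rewrite subr0 => /(_ zw wz0) /=.
  rewrite [_ *: 1]mulr1 subrK [_ *: _]mulrC => /ltW.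
  rewrite -(ler_pM2r (x := nm (w - z))) ?nm_gt0 // -nmM mulrBl.
  by rewrite divfK.
apply/cvg_ex; exists l => P /nbhs_nmP [e e0 eP].
have e20 : 0 < e / 2 by rewrite divr_gt0.
have [d d0 dP] := fl _ e20.
apply/nbhs_nmP; exists d => // h; rewrite subr0 => hd h0 /=; apply: eP.
have := dP (h + z); rewrite addrK => /(_ hd).
rewrite [_ *: 1]mulr1 [_ *: _]mulrC => le1.
have h0' : 0 < nm h by rewrite nm_gt0.
rewrite -(ltr_pM2r h0') -nmM mulrBl divfK //.
apply: (le_lt_trans le1); rewrite ltr_pM2r // ltr_pdivrMr //.
by rewrite ltr_pMr // ltr1n.
Qed.

Lemma cderiv_derivable f z l : cderiv f z l -> derivable f z 1.
Proof. by move=> fl; apply/cderivP; exists l. Qed.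

Lemma cderiv_lipschitz f z l : cderiv f z l -> exists2 d : R, 0 < d &
  forall w, nm (w - z) < d -> nm (f w - f z) <= (nm l + 1) * nm (w - z).
Proof.
move=> /(_ 1 ltr01) [d d0 dP]; exists d => // w /dP le1.
have -> : f w - f z = (f w - f z - l * (w - z)) + l * (w - z) by rewrite subrK.
apply: (le_trans (nmD _ _)); rewrite nmM mulrDl addrC lerD2l mul1r.
by rewrite mul1r in le1.
Qed.

Lemma cderiv_continuous f z l : cderiv f z l -> forall e : R, 0 < e ->
  exists2 d : R, 0 < d & forall w, nm (w - z) < d -> nm (f w - f z) < e.
Proof.
move=> /cderiv_lipschitz [d d0 dP] e e0.
have K0 : 0 < nm l + 1 by rewrite ltr_wpDl // nm_ge0.
exists (Num.min d (e / (nm l + 1))); first by rewrite lt_min d0 divr_gt0.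
move=> w; rewrite lt_min => /andP[/dP le1 lt2].
by apply: (le_lt_trans le1); rewrite mulrC -ltr_pdivlMr.
Qed.

Lemma derivable_continuous_nm (f : C -> C) z : derivable f z 1 -> forall e : R, 0 < e ->
  exists2 d : R, 0 < d & forall w, nm (w - z) < d -> nm (f w - f z) < e.
Proof. by move=> /cderivP [l /cderiv_continuous]. Qed.

Lemma cderiv_near f g z l (d : R) : 0 < d ->
  (forall w, nm (w - z) < d -> f w = g w) -> cderiv f z l -> cderiv g z l.
Proof.
move=> d0 fg fl e /fl [d' d'0 d'P].
exists (Num.min d d'); first by rewrite lt_min d0.
move=> w; rewrite lt_min => /andP[wd /d'P].
by rewrite !fg // subrr nm0.
Qed.

Lemma cderiv_unique f z l m : cderiv f z l -> cderiv f z m -> l = m.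
Proof.
move=> fl fm; apply/eqP; rewrite -subr_eq0 -nm_eq0; apply/eqP/le_anti.
rewrite nm_ge0 andbT; apply/ler_addgt0Pl => e e0; rewrite addr0.
have e20 : 0 < e / 2 by rewrite divr_gt0.
have [d d0 dP] := fl _ e20; have [d' d'0 d'P] := fm _ e20.
(* A test point at a positive distance inside both radii; a real displacement is enough. *)
pose h : R := Num.min d d' / 2.
have h0 : 0 < h by rewrite divr_gt0 // lt_min d0.
have hd : h < Num.min d d' by rewrite ltr_pdivrMr // ltr_pMr ?ltr1n // lt_min d0.
pose w : C := z + (h%:C)%C.
have wz : w - z = (h%:C)%C by rewrite /w addrC addKr.
have nmw : nm (w - z) = h by rewrite wz nm_real gtr0_norm.
have := dP w; have := d'P w; rewrite nmw.
move: hd; rewrite lt_min => /andP[hd hd'] /(_ hd') le1 /(_ hd) le2.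
rewrite -(ler_pM2r h0) -{1}nmw -nmM.
have -> : (l - m) * (w - z) = (f w - f z - m * (w - z)) - (f w - f z - l * (w - z)).
  by ring.
apply: (le_trans (nmB _ _)); apply: (le_trans (lerD le1 le2)).
by rewrite -mulrDl -splitr.
Qed.

Lemma cderiv_comp f g z l m :
  cderiv g z m -> cderiv f (g z) l -> cderiv (f \o g) z (l * m).
Proof.
move=> gm fl e e0.
have [d1 d10 d1P] := cderiv_lipschitz gm.
have K0 : 0 < nm m + 1 by rewrite ltr_wpDl // nm_ge0.
have L0 : 0 < nm l + 1 by rewrite ltr_wpDl // nm_ge0.
have [d2 d20 d2P] := fl (e / 2 / (nm m + 1)) (divr_gt0 (divr_gt0 e0 (ltr0Sn _ 1)) K0).
have [d3 d30 d3P] := cderiv_continuous gm d20.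
have [d4 d40 d4P] := gm (e / 2 / (nm l + 1)) (divr_gt0 (divr_gt0 e0 (ltr0Sn _ 1)) L0).
exists (Num.min d1 (Num.min d3 d4)); first by rewrite !lt_min d10 d30.
move=> w; rewrite !lt_min => /and3P[/d1P le1 /d3P /d2P le2 /d4P le4] /=.
have -> : f (g w) - f (g z) - l * m * (w - z) =
  (f (g w) - f (g z) - l * (g w - g z)) + l * (g w - g z - m * (w - z)) by ring.
apply: (le_trans (nmD _ _)); rewrite nmM [e in leRHS]splitr mulrDl.
apply: lerD.
  apply: (le_trans le2); rewrite mulrAC ler_pdivrMr // -[leRHS]mulrA.
  rewrite ler_pM2l ?divr_gt0 //.
  by rewrite mulrC.
apply: (@le_trans _ _ ((nm l + 1) * nm (g w - g z - m * (w - z)))).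
  by rewrite ler_wpM2r ?nm_ge0 // lerDl.
apply: (le_trans (ler_wpM2l (ltW L0) le4)).
by rewrite mulrA [X in X * _]mulrC divfK ?gt_eqF.
Qed.

Lemma derivable_fun_cst (a z : C) : derivable (fun=> a) z 1.
Proof. exact: derivable_cst. Qed.

Lemma derivable_fun_id z : derivable (fun w : C => w) z 1.
Proof. exact: derivable_id. Qed.

Lemma derivable_funD (f g : C -> C) z : derivable f z 1 -> derivable g z 1 ->
  derivable (fun w => f w + g w) z 1.
Proof. exact: derivableD. Qed.

Lemma derivable_funB (f g : C -> C) z : derivable f z 1 -> derivable g z 1 ->
  derivable (fun w => f w - g w) z 1.
Proof. exact: derivableB. Qed.

Lemma derivable_funM (f g : C -> C) z : derivable f z 1 -> derivable g z 1 ->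
  derivable (fun w => f w * g w) z 1.
Proof. exact: derivableM. Qed.

Lemma derivable_funX (f : C -> C) n z : derivable f z 1 ->
  derivable (fun w => f w ^+ n) z 1.
Proof.
move=> df; elim: n => [|n IH]; first exact: derivable_cst.
under eq_fun do rewrite exprS.
exact: derivable_funM.
Qed.

Lemma derivable_funV (f : C -> C) z : f z != 0 -> derivable f z 1 ->
  derivable (fun w => (f w)^-1) z 1.
Proof. exact: derivableV. Qed.

Lemma derivable_fun_div (f g : C -> C) z : g z != 0 -> derivable f z 1 ->
  derivable g z 1 -> derivable (fun w => f w / g w) z 1.
Proof. by move=> gz df dg; exact (derivable_funM df (derivable_funV gz dg)). Qed.

End Modulus.

(** * Goursat's lemma *)

Section Primitive.
Variable R : realType.
Implicit Types (a b c d x : R) (h k : R -> R).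

Definition prim a h x : R := parameterized_integral lebesgue_measure a x h.

Lemma prim_continuous a b h : a <= b -> {within `[a, b], continuous h} ->
  {within `[a, b], continuous (prim a h)}.
Proof.
move=> ab ch; apply: parameterized_integral_continuous => //.
by apply: continuous_compact_integrable => //; exact: segment_compact.
Qed.

Lemma is_derive_prim a b h x : {within `[a, b], continuous h} ->
  x \in `]a, b[%R -> is_derive x 1 (prim a h) (h x).
Proof.
rewrite in_itv /= => ch /andP[ax xb].
have ab : a < b by exact: lt_trans xb.
have ih : lebesgue_measure.-integrable `[a, b] (EFin \o h).
  by apply: continuous_compact_integrable => //; exact: segment_compact.
have cx : {for x, continuous h}.
  have [cc _ _] := (continuous_within_itvP h ab).1 ch.
  by apply: cc; rewrite in_itv /= ax.
have [dF F'] := continuous_FTC1_closed xb ih ax cx.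
by apply: DeriveDef => //; rewrite -F' derive1E.
Qed.

(** The mean value theorem is applied to the difference of the two primitives, so that one point
    [xi] serves both integrands. In [goursat] this compares opposite sides of a rectangle at a
    common height or abscissa. *)
Lemma prim_MVT a b h k c d :
  {within `[a, b], continuous h} -> {within `[a, b], continuous k} ->
  a <= c -> c < d -> d <= b ->
  exists2 xi, c <= xi <= d &
    (prim a h d - prim a h c) - (prim a k d - prim a k c) =
    (h xi - k xi) * (d - c).
Proof.
move=> ch ck ac cd db.
have ab : a <= b by exact: le_trans ac (le_trans (ltW cd) db).
pose F : R -> R := prim a h \- prim a k.
have dF x : x \in `]c, d[%R -> is_derive x 1 F ((h \- k) x).
  rewrite in_itv /= => /andP[cx xd]; apply: is_deriveB;
    apply: (@is_derive_prim _ b) => //; rewrite in_itv /=.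
    by rewrite (le_lt_trans ac cx) (lt_le_trans xd db).
  by rewrite (le_lt_trans ac cx) (lt_le_trans xd db).
have cF : {within `[c, d], continuous F}.
  apply: (@continuous_subspaceW _ _ _ `[a, b]).
    by apply: subset_itvScc; rewrite bnd_simp.
  move=> x; apply: continuousB; exact: prim_continuous.
have [xi] := MVT cd dF cF; rewrite in_itv /= => /andP[cxi xid] E.
exists xi; first by rewrite !ltW.
by rewrite -[h xi - k xi]/((h \- k) xi) -E /F /=; ring.
Qed.

Lemma prim_MVT0 a b h c d :
  {within `[a, b], continuous h} -> a <= c -> c < d -> d <= b ->
  exists2 xi, c <= xi <= d & prim a h d - prim a h c = h xi * (d - c).
Proof.
move=> ch ac cd db.
have ck : {within `[a, b], continuous (fun=> 0 : R)} by move=> x; exact: cvg_cst.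
have [xi xiP E] := prim_MVT ch ck ac cd db.
exists xi => //.
have p0 x : prim a (fun=> 0) x = 0.
  by rewrite /prim /parameterized_integral /Rintegral integral0.
by move: E; rewrite !p0 !subr0.
Qed.

End Primitive.

Section Goursat.
Variable R : realType.

(* [F x] and [G y] stand for primitives of [B x] and [A ^~ y], so this is the
   integral of [A dx + B dy] around the boundary of [[a, b] x [c, d]]. *)
Definition circulation (F G : R -> R -> R) (a b c d : R) : R :=
  ((F b d - F b c) - (F a d - F a c)) - ((G d b - G d a) - (G c b - G c a)).

Lemma circulation_periodic (F G : R -> R -> R) (a b c d : R) : G d = G c ->
  circulation F G a b c d = 0 -> F b d - F b c = F a d - F a c.
Proof. by rewrite /circulation => -> ; rewrite subrr subr0 => /subr0_eq. Qed.

Lemma bisect_rectangle (J : R -> R -> R -> R -> R) a b c d :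
  a < b -> c < d ->
  (forall a b c d m k : R, J a b c d = J a m c k + J m b c k + J a m k d + J m b k d) ->
  exists q : R * R * R * R, let: (a', b', c', d') := q in
    [/\ a <= a' /\ b' <= b, c <= c' /\ d' <= d,
        b' - a' = (b - a) / 2, d' - c' = (d - c) / 2 &
        `|J a b c d| / 4 <= `|J a' b' c' d'|].
Proof.
move=> ab cd Jadd.
set m := (a + b) / 2; set k := (c + d) / 2.
have am : a <= m by rewrite /m; lra.
have mb : m <= b by rewrite /m; lra.
have ck : c <= k by rewrite /k; lra.
have kd : k <= d by rewrite /k; lra.
have e1 : m - a = (b - a) / 2 by rewrite /m; lra.
have e2 : b - m = (b - a) / 2 by rewrite /m; lra.
have e3 : k - c = (d - c) / 2 by rewrite /k; lra.
have e4 : d - k = (d - c) / 2 by rewrite /k; lra.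
have [h1|h1] := leP (`|J a b c d| / 4) `|J a m c k|.
  by exists (a, m, c, k).
have [h2|h2] := leP (`|J a b c d| / 4) `|J m b c k|.
  by exists (m, b, c, k).
have [h3|h3] := leP (`|J a b c d| / 4) `|J a m k d|.
  by exists (a, m, k, d).
have [h4|h4] := leP (`|J a b c d| / 4) `|J m b k d|.
  by exists (m, b, k, d).
exfalso.
have := ler_normD (J a m c k + J m b c k + J a m k d) (J m b k d).
have := ler_normD (J a m c k + J m b c k) (J a m k d).
have := ler_normD (J a m c k) (J m b c k).
rewrite -Jadd; lra.
Qed.

Lemma nested_intervals (a b : nat -> R) :
  (forall n, a n <= a n.+1) -> (forall n, b n.+1 <= b n) ->
  (forall n, a n <= b n) -> exists x, forall n, a n <= x <= b n.
Proof.
move=> ha hb hab.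
have ham i j : (i <= j)%N -> a i <= a j by exact: (nondecreasing_seqP a).1.
have hbm i j : (i <= j)%N -> b j <= b i by exact: (nonincreasing_seqP b).1.
have ub n : ubound (range a) (b n).
  move=> _ [m _ <-]; case/orP: (leq_total m n) => mn.
    by apply: le_trans (hab n); exact: ham.
  by apply: le_trans (hab m) _; exact: hbm.
have hs : has_sup (range a) by split; [exists (a 0%N), 0%N|exists (b 0%N)].
exists (sup (range a)) => n; apply/andP; split.
  by apply: (sup_upper_bound hs); exists n.
exact: (ge_sup hs.1 (ub n)).
Qed.

(** Here [B] and [A] are the real and imaginary parts of a function with derivative [l + i m] at
    [(x0, y0)], and the circulation is the imaginary part of its contour integral. Quartering loses
    a factor 4 in the circulation at each stage, while the bound on a rectangle of size W / 2^n
    around the nested point is of order e (W / 2^n)^2, so n cancels. The integrals enter only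
    through differences over opposite sides, each evaluated at one intermediate point. *)
Lemma goursat (A B F G : R -> R -> R) (a b c d : R) : a < b -> c < d ->
  (forall x1 x2 y1 y2, a <= x1 <= b -> a <= x2 <= b -> c <= y1 -> y1 < y2 ->
    y2 <= d -> exists2 xi, y1 <= xi <= y2 &
    (F x2 y2 - F x2 y1) - (F x1 y2 - F x1 y1) =
    (B x2 xi - B x1 xi) * (y2 - y1)) ->
  (forall y1 y2 x1 x2, c <= y1 <= d -> c <= y2 <= d -> a <= x1 -> x1 < x2 ->
    x2 <= b -> exists2 xi, x1 <= xi <= x2 &
    (G y2 x2 - G y2 x1) - (G y1 x2 - G y1 x1) =
    (A xi y2 - A xi y1) * (x2 - x1)) ->
  (forall x0 y0, a <= x0 <= b -> c <= y0 <= d -> exists l m : R,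
    forall e, 0 < e -> exists2 del, 0 < del & forall x y,
      a <= x <= b -> c <= y <= d -> `|x - x0| < del -> `|y - y0| < del ->
      `|B x y - B x0 y0 - (l * (x - x0) - m * (y - y0))|
        <= e * (`|x - x0| + `|y - y0|) /\
      `|A x y - A x0 y0 - (m * (x - x0) + l * (y - y0))|
        <= e * (`|x - x0| + `|y - y0|)) ->
  circulation F G a b c d = 0.
Proof.
move=> ab cd FP GP dP; set J := circulation F G.
have Jadd (a' b' c' d' m k : R) : J a' b' c' d' =
    J a' m c' k + J m b' c' k + J a' m k d' + J m b' k d'.
  by rewrite /J /circulation; ring.
(* On degenerate rectangles the relation is vacuous, so that a total function [step] can be
   chosen. *)
pose P (q q' : R * R * R * R) :=
  let: (a, b, c, d) := q in let: (a', b', c', d') := q' in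
    a < b -> c < d -> [/\ a <= a' /\ b' <= b, c <= c' /\ d' <= d,
        b' - a' = (b - a) / 2, d' - c' = (d - c) / 2 &
        `|J a b c d| / 4 <= `|J a' b' c' d'|].
have /choice [step stepP] : forall q, exists q', P q q'.
  move=> [[[a1 b1] c1] d1].
  case: (pselect (a1 < b1 /\ c1 < d1)) => [[ab1 cd1]|N].
    have [[[[a2 b2] c2] d2] Q] := bisect_rectangle ab1 cd1 Jadd.
    by exists (a2, b2, c2, d2).
  by exists (a1, b1, c1, d1) => ab1 cd1; case: N.
pose q n := iter n step (a, b, c, d).
pose qa n := (q n).1.1.1; pose qb n := (q n).1.1.2.
pose qc n := (q n).1.2; pose qd n := (q n).2.
have qE n : q n = (qa n, qb n, qc n, qd n).
  by rewrite /qa /qb /qc /qd; case: (q n) => [[[? ?] ?] ?].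
have pow0 n : (0 : R) < 2 ^+ n by rewrite exprn_gt0.
have qI n : [/\ qb n - qa n = (b - a) / 2 ^+ n,
                qd n - qc n = (d - c) / 2 ^+ n &
                `|J a b c d| / 4 ^+ n <= `|J (qa n) (qb n) (qc n) (qd n)|] /\
    [/\ qa n <= qa n.+1, qb n.+1 <= qb n, qc n <= qc n.+1 & qd n.+1 <= qd n].
  (* Nesting at stage [m] presupposes positive side lengths there, so the invariant is propagated
     together with it. *)
  have aux m : [/\ qb m - qa m = (b - a) / 2 ^+ m,
                qd m - qc m = (d - c) / 2 ^+ m &
                `|J a b c d| / 4 ^+ m <= `|J (qa m) (qb m) (qc m) (qd m)|] ->
    [/\ qb m.+1 - qa m.+1 = (b - a) / 2 ^+ m.+1,
                qd m.+1 - qc m.+1 = (d - c) / 2 ^+ m.+1 &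
                `|J a b c d| / 4 ^+ m.+1 <=
                  `|J (qa m.+1) (qb m.+1) (qc m.+1) (qd m.+1)|] /\
    [/\ qa m <= qa m.+1, qb m.+1 <= qb m, qc m <= qc m.+1 & qd m.+1 <= qd m].
    move=> [w h Jm].
    have := stepP (q m); rewrite -[step _]/(q m.+1) qE (qE m.+1) /P.
    have ltab : qa m < qb m by rewrite -subr_gt0 w divr_gt0 // subr_gt0.
    have ltcd : qc m < qd m by rewrite -subr_gt0 h divr_gt0 // subr_gt0.
    move=> /(_ ltab ltcd) [[? ?] [? ?] w' h' J'].
    split=> //; split.
    - by rewrite w' w exprS invfM; ring.
    - by rewrite h' h exprS invfM; ring.
    - apply: le_trans J'.
      rewrite exprS invfM (mulrC 4^-1) mulrA ler_pM2r //; lra.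
  have Q m : [/\ qb m - qa m = (b - a) / 2 ^+ m,
                qd m - qc m = (d - c) / 2 ^+ m &
                `|J a b c d| / 4 ^+ m <= `|J (qa m) (qb m) (qc m) (qd m)|].
    elim: m => [|m /aux[]//].
    by rewrite !expr0 !divr1.
  by split=> //; have [] := aux n (Q n).
have lt_ab n : qa n < qb n.
  by have [[w _ _] _] := qI n; rewrite -subr_gt0 w divr_gt0 // subr_gt0.
have lt_cd n : qc n < qd n.
  by have [[_ w _] _] := qI n; rewrite -subr_gt0 w divr_gt0 // subr_gt0.
have [x0 x0P] : exists x, forall n, qa n <= x <= qb n.
  by apply: nested_intervals => n; [have [_ []] := qI n|have [_ []] := qI n|exact: ltW].
have [y0 y0P] : exists x, forall n, qc n <= x <= qd n.
  by apply: nested_intervals => n; [have [_ []] := qI n|have [_ []] := qI n|exact: ltW].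
have qsub n : [/\ a <= qa n, qb n <= b, c <= qc n & qd n <= d].
  elim: n => [//|n [h1 h2 h3 h4]]; have [_ [g1 g2 g3 g4]] := qI n; split.
  - exact: le_trans g1.
  - exact: le_trans h2.
  - exact: le_trans g3.
  - exact: le_trans h4.
have [l [m dlm]] := dP x0 y0 (x0P 0%N) (y0P 0%N).
pose W := (b - a) + (d - c).
have W0 : 0 < W by rewrite /W; lra.
suff bd e : 0 < e -> `|J a b c d| <= 4 * W ^+ 2 * e.
  apply/eqP; rewrite -normr_eq0; apply/eqP/le_anti; rewrite normr_ge0 andbT.
  apply/ler_addgt0Pl => e e0; rewrite addr0.
  have W4 : 0 < 4 * W ^+ 2 by rewrite mulr_gt0 // exprn_gt0.
  have := bd (e / (4 * W ^+ 2)); rewrite divr_gt0 // => /(_ isT).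
  by rewrite mulrC divfK ?gt_eqF.
move=> e0; have [del del0 delP] := dlm e e0.
(* Deep enough that the whole rectangle lies where the linear approximation at [(x0, y0)] has
   relative error [e]. *)
have [n nP] : exists n : nat, W / 2 ^+ n < del.
  have [N NP] : exists N : nat, W / del < N%:R.
    exists (Num.truncn (W / del)).+1; rewrite truncnS_gt //.
  exists N; rewrite ltr_pdivrMr // mulrC -ltr_pdivrMr //.
  by apply: (lt_trans NP); rewrite -natrX ltr_nat ltn_expl.
have [[w h JP] _] := qI n.
have [sa sb sc sd] := qsub n.
have /andP[x1 x2] := x0P n; have /andP[y1 y2] := y0P n.
have ltab := lt_ab n; have ltcd := lt_cd n.
have whn : (qb n - qa n) + (qd n - qc n) = W / 2 ^+ n by rewrite w h /W; ring.
set w' := qb n - qa n in w whn; set h' := qd n - qc n in h whn.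
have w'0 : 0 < w' by rewrite subr_gt0.
have h'0 : 0 < h' by rewrite subr_gt0.
have est x y : qa n <= x <= qb n -> qc n <= y <= qd n ->
  `|B x y - B x0 y0 - (l * (x - x0) - m * (y - y0))| <= e * (w' + h') /\
  `|A x y - A x0 y0 - (m * (x - x0) + l * (y - y0))| <= e * (w' + h').
  move=> /andP[xa xb] /andP[yc yd].
  have hx : `|x - x0| <= w' by rewrite ler_norml /w'; apply/andP; split; lra.
  have hy : `|y - y0| <= h' by rewrite ler_norml /h'; apply/andP; split; lra.
  have [||||E1 E2] := delP x y.
  - by rewrite (le_trans sa xa) (le_trans xb sb).
  - by rewrite (le_trans sc yc) (le_trans yd sd).
  - by apply: (le_lt_trans hx); rewrite (lt_trans _ nP) // -whn ltrDl.
  - by apply: (le_lt_trans hy); rewrite (lt_trans _ nP) // -whn ltrDr.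
  split; [apply: (le_trans E1)|apply: (le_trans E2)];
    by rewrite ler_pM2l // lerD.
have [xi xiP Exi] := FP (qa n) (qb n) (qc n) (qd n)
  (introT andP (conj sa (le_trans (ltW ltab) sb)))
  (introT andP (conj (le_trans sa (ltW ltab)) sb)) sc ltcd sd.
have [et etP Eet] := GP (qc n) (qd n) (qa n) (qb n)
  (introT andP (conj sc (le_trans (ltW ltcd) sd)))
  (introT andP (conj (le_trans sc (ltW ltcd)) sd)) sa ltab sb.
have [b1 _] := est (qb n) xi (introT andP (conj (ltW ltab) (lexx _))) xiP.
have [b2 _] := est (qa n) xi (introT andP (conj (lexx _) (ltW ltab))) xiP.
have [_ a1] := est et (qd n) etP (introT andP (conj (ltW ltcd) (lexx _))).
have [_ a2] := est et (qc n) etP (introT andP (conj (lexx _) (ltW ltcd))).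
have eB : `|B (qb n) xi - B (qa n) xi - l * w'| <= 2 * e * (w' + h').
  have -> : B (qb n) xi - B (qa n) xi - l * w' =
    (B (qb n) xi - B x0 y0 - (l * (qb n - x0) - m * (xi - y0))) -
    (B (qa n) xi - B x0 y0 - (l * (qa n - x0) - m * (xi - y0))).
    by rewrite /w'; ring.
  by apply: (le_trans (ler_normB _ _)); rewrite -mulrA mulr_natl mulr2n lerD.
have eA : `|A et (qd n) - A et (qc n) - l * h'| <= 2 * e * (w' + h').
  have -> : A et (qd n) - A et (qc n) - l * h' =
    (A et (qd n) - A x0 y0 - (m * (et - x0) + l * (qd n - y0))) -
    (A et (qc n) - A x0 y0 - (m * (et - x0) + l * (qc n - y0))).
    by rewrite /h'; ring.
  by apply: (le_trans (ler_normB _ _)); rewrite -mulrA mulr_natl mulr2n lerD.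
(* The Cauchy-Riemann equations act here: both linear parts contribute [l * w' * h'], with opposite
   signs, and only the errors remain. *)
have JE : J (qa n) (qb n) (qc n) (qd n) =
  (B (qb n) xi - B (qa n) xi - l * w') * h' -
  (A et (qd n) - A et (qc n) - l * h') * w'.
  by rewrite /J /circulation Exi Eet /w' /h'; ring.
have Jle : `|J (qa n) (qb n) (qc n) (qd n)| <= 2 * e * (w' + h') * (w' + h').
  rewrite JE; apply: (le_trans (ler_normB _ _)); rewrite !normrM.
  rewrite (gtr0_norm w'0) (gtr0_norm h'0).
  have -> : 2 * e * (w' + h') * (w' + h') =
    2 * e * (w' + h') * h' + 2 * e * (w' + h') * w' by ring.
  by apply: lerD; rewrite ler_pM2r.
have := le_trans JP Jle; rewrite whn.
have -> : (4 : R) = 2 ^+ 2 by rewrite -natrX.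
rewrite -exprM mulnC exprM ler_pdivrMr ?exprn_gt0 // => le1.
apply: (le_trans le1).
have -> : 2 * e * (W / 2 ^+ n) * (W / 2 ^+ n) * (2 ^+ n) ^+ 2 = 2 * W ^+ 2 * e.
  by field; rewrite gt_eqF.
rewrite ler_pM2r // ler_pM2r ?exprn_gt0 // -natrX ler_nat //.
Qed.

End Goursat.

(** * The mean value inequality *)

Section MeanValue.
Variable R : realType.
Local Notation C := (Cplx R).
Implicit Types (z w c l : C).

Lemma is_derive_eps (f : R -> R) (x l : R) : is_derive x 1 f l ->
  forall e : R, 0 < e -> exists2 d : R, 0 < d & forall h, `|h| < d ->
    `|f (x + h) - f x - l * h| <= e * `|h|.
Proof.
move=> df e e0.
have [/cvgrPdist_le/(_ e e0) + dl] := df.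
rewrite -[lim _]/(derive f x 1) dl => /nbhs_normP[d /= d0 dP].
exists d => // h hd.
have [->|h0] := eqVneq h 0; first by rewrite addr0 !mulr0 subrr subr0 normr0 mulr0.
have := dP h; rewrite /= sub0r normrN => /(_ hd h0).
rewrite [_ *: 1]mulr1 [_ *: _]mulrC distrC (addrC h) => le1.
have hp : 0 < `|h| by rewrite normr_gt0.
by rewrite -(ler_pM2r hp) -normrM mulrBl divfK in le1.
Qed.

Definition Cexp (z : C) : C :=
  Complex (expR (complex.Re z) * cos (complex.Im z))
          (expR (complex.Re z) * sin (complex.Im z)).

Lemma CexpD z w : Cexp (z + w) = Cexp z * Cexp w.
Proof.
case: z => a b; case: w => x y; rewrite /Cexp /= expRD cosD sinD.
by apply/eqP; rewrite eq_complex /=; apply/andP; split; apply/eqP; ring.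
Qed.

Lemma Cexp0 : Cexp 0 = 1.
Proof. by rewrite /Cexp /= expR0 cos0 sin0 mulr0 mulr1. Qed.

Lemma nm_Cexp z : nm (Cexp z) = expR (complex.Re z).
Proof.
by rewrite nm_sqrt /= !exprMn -mulrDr cos2Dsin2 mulr1 sqrtr_sqr ger0_norm ?expR_ge0.
Qed.

Lemma Cexp_per (x y : R) : Cexp (Complex x (y + pi *+ 2)) = Cexp (Complex x y).
Proof. by rewrite /Cexp /= cosD2pi sinD2pi. Qed.

Lemma cderiv_Cexp0 : cderiv Cexp 0 1.
Proof.
move=> e e0.
(* The real part will cost [3 * t] and the imaginary part [5 * t], in all [8 * t <= e]. The bound by
   1 keeps [|x| <= 1]. *)
pose t : R := Num.min 1 (e / 8).
have t0 : 0 < t by rewrite /t lt_min ltr01 divr_gt0.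
have t1 : t <= 1 by rewrite /t ge_min lexx.
have te : t <= e / 8 by rewrite /t ge_min lexx orbT.
clearbody t.
have [d1 d10 d1P] := is_derive_eps (is_derive_expR 0) t0.
have [d2 d20 d2P] := is_derive_eps (is_derive_cos 0) t0.
have [d3 d30 d3P] := is_derive_eps (is_derive_sin 0) t0.
exists (Num.min t (Num.min d1 (Num.min d2 d3))).
  by rewrite !lt_min t0 d10 d20.
move=> [x y]; rewrite Cexp0 !subr0 !lt_min => /and4P[ht h1 h2 h3].
set w : C := Complex x y in ht h1 h2 h3 *.
have nx : `|x| <= nm w by exact: (nm_Re w).
have ny : `|y| <= nm w by exact: (nm_Im w).
have := d1P x (le_lt_trans nx h1).
have := d2P y (le_lt_trans ny h2).
have := d3P y (le_lt_trans ny h3).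
rewrite !add0r expR0 cos0 sin0 oppr0 mul0r !mul1r !subr0 addr0 => es ec ee.
have ny0 := nm_ge0 w.
have hx1 : `|x| <= 1 by apply: (le_trans nx); rewrite (le_trans (ltW ht)).
have bs : `|sin y - y| <= t * nm w by apply: (le_trans es); rewrite ler_pM2l.
have bc : `|cos y - 1| <= t * nm w by apply: (le_trans ec); rewrite ler_pM2l.
have be : `|expR x - 1 - x| <= t * nm w by apply: (le_trans ee); rewrite ler_pM2l.
have cos1 : `|cos y| <= 1 by rewrite ler_norml cos_geN1 cos_le1.
have bre : `|expR x * cos y - 1 - x| <= 3 * t * nm w.
  have -> : expR x * cos y - 1 - x =
    (expR x - 1 - x) * cos y + (1 + x) * (cos y - 1) by ring.
  apply: (le_trans (ler_normD _ _)); rewrite !normrM.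
  have -> : 3 * t * nm w = t * nm w * 1 + 2 * (t * nm w) by ring.
  apply: lerD; apply: ler_pM => //.
  by apply: (le_trans (ler_normD _ _)); rewrite normr1; lra.
have bim : `|expR x * sin y - y| <= 5 * t * nm w.
  have -> : expR x * sin y - y = (expR x - 1) * sin y + (sin y - y) by ring.
  apply: (le_trans (ler_normD _ _)); rewrite !normrM.
  have -> : 5 * t * nm w = (2 * t) * (2 * nm w) + t * nm w by ring.
  apply: lerD => //; apply: ler_pM => //.
    have -> : expR x - 1 = (expR x - 1 - x) + x by ring.
    apply: (le_trans (ler_normD _ _)).
    have tt : t * nm w <= t.
      by apply: ler_piMr; [exact: ltW|exact: le_trans (ltW ht) t1].
    have := le_trans nx (ltW ht); lra.
  have -> : sin y = (sin y - y) + y by ring.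
  apply: (le_trans (ler_normD _ _)).
  have tt : t * nm w <= nm w by rewrite ler_piMl.
  lra.
apply: (le_trans (nm_le_ReIm _)).
have -> : complex.Re (Cexp w - 1 - w) = expR x * cos y - 1 - x by [].
have -> : complex.Im (Cexp w - 1 - w) = expR x * sin y - y.
  by rewrite !ImB /= subr0.
apply: (le_trans (lerD bre bim)); rewrite -mulrDl ler_wpM2r //.
lra.
Qed.

Lemma cderiv_Cexp z : cderiv Cexp z (Cexp z).
Proof.
move=> e e0; have ez : 0 < nm (Cexp z) by rewrite nm_Cexp expR_gt0.
have [d d0 dP] := cderiv_Cexp0 (divr_gt0 e0 ez).
exists d => // w wz; have := dP (w - z); rewrite subr0 => /(_ wz).
rewrite Cexp0 mul1r => le1.
have -> : Cexp w - Cexp z - Cexp z * (w - z) =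
    Cexp z * (Cexp (w - z) - 1 - (w - z)).
  have {1}-> : w = z + (w - z) by rewrite addrC subrK.
  by rewrite CexpD; ring.
rewrite nmM mulrC -ler_pdivlMr //; apply: (le_trans le1).
by rewrite mulrAC.
Qed.

(** With z = c + exp(x + i y), the circles of radii [s1] and [s] become the vertical sides of a
    rectangle. Zero circulation and the cancellation of the horizontal sides say that the real part
    of [g] has the same angular integral on both circles. It is close to that of [l] on the small
    one and at most [M] on the large one. *)
Lemma mean_value_Re (g : C -> C) c l (rho s M : R) : 0 < s < rho ->
  (forall z, 0 < nm (z - c) < rho -> derivable g z 1) ->
  (forall e : R, 0 < e -> exists2 d : R, 0 < d &
     forall z, 0 < nm (z - c) < d -> nm (g z - l) <= e) ->
  (forall z, nm (z - c) = s -> complex.Re (g z) <= M) ->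
  complex.Re l <= M.
Proof.
move=> /andP[s0 srho] dg gl gM.
apply/ler_addgt0Pl => e e0.
have [d d0 dP] := gl e e0.
pose s1 := Num.min (s / 2) (d / 2).
have s10 : 0 < s1 by rewrite lt_min !divr_gt0.
have s1s : s1 < s by rewrite /s1 gt_min; apply/orP; left; lra.
have s1d : s1 < d by rewrite /s1 gt_min; apply/orP; right; lra.
pose x1 := ln s1; pose x2 := ln s.
have x12 : x1 < x2 by rewrite ltr_ln.
have pi0 : (0 : R) < pi *+ 2 by rewrite mulrn_wgt0 // pi_gt0.
pose V (z : C) : C := g (c + Cexp z).
have dV z : complex.Re z <= x2 -> exists L, cderiv V z L.
  move=> zx2.
  have : 0 < nm (c + Cexp z - c) < rho.
    rewrite addrC addKr nm_Cexp expR_gt0 /=; apply: le_lt_trans srho.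
    by rewrite -[leRHS](lnK s0) ler_expR.
  move=> /dg/cderivP [L gL]; exists (L * Cexp z).
  apply: (@cderiv_comp _ g (fun z => c + Cexp z)) => //.
  move=> e' e'0; have [d' d'0 d'P] := cderiv_Cexp z e'0.
  exists d' => // w /d'P.
  by have -> : c + Cexp w - (c + Cexp z) = Cexp w - Cexp z by ring.
pose B x y : R := complex.Re (V (Complex x y)).
pose A x y : R := complex.Im (V (Complex x y)).
pose F x y := prim 0 (B x) y.
pose G y x := prim x1 (fun x => A x y) x.
have cB x : x1 <= x <= x2 -> {within `[0, pi *+ 2], continuous (B x)}.
  move=> /andP[_ xx2].
  have cV y : `[0 : R, pi *+ 2] y -> forall e, 0 < e -> exists2 d : R, 0 < d &
      forall y', `[0 : R, pi *+ 2] y' -> `|y' - y| < d ->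
      nm (V (Complex x y') - V (Complex x y)) < e.
    move=> _ e' e'0; have [L VL] := dV (Complex x y) xx2.
    have [d' d'0 d'P] := cderiv_continuous VL e'0.
    exists d' => // y' _ yy'; apply: d'P; apply: le_lt_trans yy'.
    by apply: (le_trans (nm_le_ReIm _)); rewrite /= subrr normr0 add0r.
  by have [] := within_continuous_ReIm (f := fun y => V (Complex x y)) cV.
have cA y : {within `[x1, x2], continuous (fun x => A x y)}.
  have cV x : `[x1, x2] x -> forall e, 0 < e -> exists2 d : R, 0 < d &
      forall x', `[x1, x2] x' -> `|x' - x| < d ->
      nm (V (Complex x' y) - V (Complex x y)) < e.
    rewrite /= in_itv /= => /andP[_ xx2] e' e'0.
    have [L VL] := dV (Complex x y) xx2.
    have [d' d'0 d'P] := cderiv_continuous VL e'0.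
    exists d' => // x' _ xx'; apply: d'P; apply: le_lt_trans xx'.
    by apply: (le_trans (nm_le_ReIm _)); rewrite /= subrr normr0 addr0.
  by have [] := within_continuous_ReIm (f := fun x => V (Complex x y)) cV.
have circ0 : circulation F G x1 x2 0 (pi *+ 2) = 0.
  apply: (@goursat _ A B) => //.
  - move=> u1 u2 y1 y2 hu1 hu2 hy1 hy12 hy2.
    exact: (prim_MVT (cB _ hu2) (cB _ hu1)).
  - move=> u1 u2 y1 y2 hu1 hu2 hy1 hy12 hy2.
    exact: (prim_MVT (cA _) (cA _)).
  - move=> x0 y0 /andP[_ x0P] y0P.
    have [[p q] VL] := dV (Complex x0 y0) x0P.
    exists p, q => e' e'0.
    have [d' d'0 d'P] := VL e' e'0.
    exists (d' / 2); first by rewrite divr_gt0.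
    move=> x y xP yP xd yd.
    have nmle : nm ((Complex x y : C) - Complex x0 y0) <= `|x - x0| + `|y - y0|.
      exact: nm_le_ReIm.
    have /d'P le1 : nm ((Complex x y : C) - Complex x0 y0) < d'.
      by apply: (le_lt_trans nmle); lra.
    have le2 : e' * nm ((Complex x y : C) - Complex x0 y0)
        <= e' * (`|x - x0| + `|y - y0|) by rewrite ler_pM2l.
    have le3 := le_trans le1 le2.
    split; apply: le_trans le3.
    + apply: le_trans (nm_Re _); rewrite /B.
      by case: (V (Complex x y)) => ? ?; case: (V (Complex x0 y0)) => ? ?.
    + apply: le_trans (nm_Im _); rewrite /A.
      case: (V (Complex x y)) => ? ?; case: (V (Complex x0 y0)) => ? ? /=.
      by rewrite [p * _ + _]addrC.
have Gper : G (pi *+ 2) = G 0.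
  apply/funext => x; rewrite /G; congr prim; apply/funext => x'.
  by rewrite /A /V -[pi *+ 2]add0r Cexp_per.
have := circulation_periodic Gper circ0.
have x2in : x1 <= x2 <= x2 by rewrite lexx andbT ltW.
have x1in : x1 <= x1 <= x2 by rewrite lexx /= ltW.
(* Each vertical integral is 2 pi times a value of [B] on that side, so some value on the small
   circle equals some value on the large one. *)
have [xi xiP Exi] := prim_MVT0 (cB x2 x2in) (lexx 0) pi0 (lexx _).
have [xi' xi'P Exi'] := prim_MVT0 (cB x1 x1in) (lexx 0) pi0 (lexx _).
rewrite Exi Exi' {Exi Exi'}.
rewrite subr0 => /mulIf; rewrite gt_eqF // => /(_ isT) E.
have : complex.Re l - e <= B x1 xi'.
  have /dP : 0 < nm (c + Cexp (Complex x1 xi') - c) < d.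
    by rewrite addrC addKr nm_Cexp expR_gt0 /= lnK.
  move=> /(le_trans (nm_Re _)); rewrite ReB distrC => /ler_normlP [].
  rewrite /B /V; lra.
rewrite -E => le1; rewrite -lerBlDl; apply: (le_trans le1); apply: gM.
by rewrite addrC addKr nm_Cexp /= lnK.
Qed.

(** A rotation [a] of modulus 1 with [l * a = |l|] reduces the modulus to the real part. *)
Lemma mean_value_nm (g : C -> C) c l (rho s M : R) : 0 < s < rho ->
  (forall z, 0 < nm (z - c) < rho -> derivable g z 1) ->
  (forall e : R, 0 < e -> exists2 d : R, 0 < d &
     forall z, 0 < nm (z - c) < d -> nm (g z - l) <= e) ->
  (forall z, nm (z - c) = s -> nm (g z) <= M) ->
  nm l <= M.
Proof.
move=> srho dg gl gM.
have /andP[s0 _] := srho.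
have [->|l0] := eqVneq l 0.
  (* For [l = 0] the claim is [0 <= M], which any point of the circle supplies. *)
  rewrite nm0; apply: le_trans (nm_ge0 _) (gM (c + (s%:C)%C) _).
  by rewrite addrC addKr nm_real gtr0_norm.
pose a : C := ((nm l)%:C)%C / l.
have na : nm a = 1.
  by rewrite /a nmM nmV nm_real ger0_norm ?nm_ge0 // divff // nm_eq0.
have la : l * a = ((nm l)%:C)%C by rewrite /a mulrC divfK.
have -> : nm l = complex.Re (l * a) by rewrite la.
refine (mean_value_Re (g := fun z => g z * a) (l := l * a) srho _ _ _).
- move=> z /dg dz; exact (derivable_funM dz (@derivable_fun_cst _ a z)).
- move=> e /gl [d d0 dP]; exists d => // z /dP.
  by rewrite -mulrBl nmM na mulr1.
- move=> z /gM; apply: le_trans; rewrite -[leRHS]mulr1 -na -nmM.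
  by apply: le_trans (nm_Re _); exact: ler_norm.
Qed.

End MeanValue.

(** * Isolated exceptional points *)

Section IsolatedPoint.
Variable R : realType.
Local Notation C := (Cplx R).
Implicit Types (z w c l p : C) (f g u : C -> C).

Definition punctured_lim (g : C -> C) c l := forall e : R, 0 < e ->
  exists2 d : R, 0 < d & forall z, 0 < nm (z - c) < d -> nm (g z - l) <= e.

Lemma punctured_limM f g c l m : punctured_lim f c l -> punctured_lim g c m ->
  punctured_lim (fun z => f z * g z) c (l * m).
Proof.
move=> fl gm e e0.
have M0 : 0 < nm m + 1 by rewrite ltr_wpDl ?nm_ge0.
have L0 : 0 < nm l + 1 by rewrite ltr_wpDl ?nm_ge0.
have e20 : 0 < e / 2 by rewrite divr_gt0.
have [d1 d10 d1P] := fl _ (divr_gt0 e20 M0).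
have t0 : 0 < Num.min 1 (e / 2 / (nm l + 1)) by rewrite lt_min ltr01 divr_gt0.
have [d2 d20 d2P] := gm _ t0.
exists (Num.min d1 d2); first by rewrite lt_min d10.
move=> z /andP[z0]; rewrite lt_min => /andP[zd1 zd2].
have le1 : nm (f z - l) <= e / 2 / (nm m + 1) by apply: d1P; rewrite z0.
have : nm (g z - m) <= Num.min 1 (e / 2 / (nm l + 1)) by apply: d2P; rewrite z0.
rewrite le_min => /andP[le2 le3].
have -> : f z * g z - l * m = (f z - l) * g z + l * (g z - m) by ring.
apply: (le_trans (nmD _ _)); rewrite !nmM.
have gz : nm (g z) <= nm m + 1.
  have -> : g z = m + (g z - m) by ring.
  by apply: (le_trans (nmD _ _)); rewrite lerD2l.
rewrite [e]splitr; apply: lerD.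
  have := ler_pM (nm_ge0 _) (nm_ge0 _) le1 gz.
  by rewrite divfK // gt_eqF.
have := ler_pM (nm_ge0 l) (nm_ge0 _) _ le3 => /(_ (nm l + 1)).
by rewrite lerDl ler01 [X in _ <= X]mulrC divfK ?gt_eqF // => /(_ isT).
Qed.

Lemma punctured_lim_cst c l : punctured_lim (fun=> l) c l.
Proof.
by move=> e e0; exists 1 => // z _; rewrite subrr nm0 ltW.
Qed.

Lemma punctured_limX g c l n : punctured_lim g c l ->
  punctured_lim (fun z => g z ^+ n) c (l ^+ n).
Proof.
move=> gl; elim: n => [|n IH]; first exact: punctured_lim_cst.
rewrite exprS (_ : (fun z => _) = (fun z => g z * g z ^+ n)).
  exact: punctured_limM.
by apply/funext => z; rewrite exprS.
Qed.

Lemma derivable_punctured_lim f z : derivable f z 1 -> punctured_lim f z (f z).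
Proof.
move=> /derivable_continuous_nm df e e0; have [d d0 dP] := df e e0.
by exists d => // w /andP[_ /dP /ltW].
Qed.

(** If y < x, then (y / x)^n tends to 0 and forces [a <= 0]. Constant factors thus disappear as in
    an n-th root, with no root taken. *)
Lemma le_of_expn_le (a b x y : R) : 0 < a -> 0 <= x -> 0 <= y ->
  (forall n, a * x ^+ n <= b * y ^+ n) -> x <= y.
Proof.
move=> a0 x0 y0 H; rewrite leNgt; apply/negP => yx.
have xp : 0 < x by exact: le_lt_trans yx.
have r1 : `|y / x| < 1.
  by rewrite ger0_norm ?divr_ge0 // ltr_pdivrMr // mul1r.
have lim0 : (fun n => b * (y / x) ^+ n) @ \oo --> (b * 0 : R).
  by apply: cvgMr; exact: cvg_expr.
have : a <= b * 0.
  apply: (cvgr_to_ge lim0); apply: nearW => n.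
  by rewrite expr_div_n mulrA ler_pdivlMr ?exprn_gt0.
by rewrite mulr0 leNgt a0.
Qed.

(* [mean_value_nm] applies to [(z - p) ^+ 2 * g z ^+ n]: the square makes it
   differentiable at [p], and its effect disappears in the n-th root. *)
Lemma mean_value_punctured g c p l (rho s M : R) : 0 < s < rho -> p != c ->
  0 <= M ->
  (forall z, 0 < nm (z - c) < rho -> z != p -> derivable g z 1) ->
  (exists2 d : R, 0 < d & exists K : R,
     forall z, 0 < nm (z - p) < d -> nm (g z) <= K) ->
  punctured_lim g c l ->
  (forall z, nm (z - c) = s -> z != p -> nm (g z) <= M) ->
  nm l <= M.
Proof.
move=> srho pc M0 dg [d d0 [K KP]] gl gM.
have a0 : 0 < nm (c - p) ^+ 2 by rewrite exprn_gt0 // nm_gt0 subr_eq0 eq_sym.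
have /andP[s0 _] := srho.
(* [b] bounds |z - p|^2 on the circle of radius [s] about [c]. *)
apply: (le_of_expn_le (b := (s + nm (c - p)) ^+ 2) a0) => // [|n].
  exact: nm_ge0.
rewrite -!nmX -nmM.
have dX z : derivable (fun z : C => (z - p) ^+ 2) z 1.
  refine (derivable_funX _).
  exact (derivable_funB (@derivable_fun_id _ z) (@derivable_fun_cst _ p z)).
refine (mean_value_nm (g := fun z => (z - p) ^+ 2 * g z ^+ n) srho _ _ _).
- move=> z zc; have [->|zp] := eqVneq z p; last first.
    exact (derivable_funM (dX z) (derivable_funX (dg z zc zp))).
  (* Near [p] the product is at most |w - p|^2 times a constant, hence has derivative 0 at [p],
     whatever the value [g p]; the added 1 makes the constant positive. *)
  apply: (@cderiv_derivable _ _ _ 0) => e e0.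
  pose B := `|K| ^+ n + 1.
  have B0 : 0 < B by rewrite ltr_wpDl // exprn_ge0.
  exists (Num.min d (e / B)); first by rewrite lt_min d0 divr_gt0.
  move=> w; rewrite lt_min => /andP[wd weB].
  rewrite subrr expr0n /= !mul0r !subr0.
  have [->|wp] := eqVneq w p; first by rewrite subrr expr0n /= mul0r nm0 mulr0.
  have np : 0 < nm (w - p) by rewrite nm_gt0 subr_eq0.
  have gw : nm (g w ^+ n) <= B.
    rewrite nmX (@le_trans _ _ (`|K| ^+ n)) // ?lerDl //.
    apply: lerXn2r; rewrite ?nnegrE ?nm_ge0 //.
    by apply: le_trans (ler_norm K); apply: KP; rewrite np.
  rewrite nmM nmX expr2 -mulrA mulrC ler_pM2r //.
  apply: (le_trans (ler_wpM2l (ltW np) gw)).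
  by rewrite -ler_pdivlMr // ltW.
- apply: (@punctured_limM (fun z => (z - p) ^+ 2) (fun z => g z ^+ n)).
    exact (derivable_punctured_lim (dX c)).
  exact: punctured_limX.
- move=> z zs; have [->|zp] := eqVneq z p.
    by rewrite subrr expr0n mul0r nm0 mulr_ge0 // exprn_ge0 // addr_ge0 ?nm_ge0 // ltW.
  rewrite nmM !nmX; apply: ler_pM; rewrite ?exprn_ge0 ?nm_ge0 //.
    apply: lerXn2r; rewrite ?nnegrE ?nm_ge0 ?addr_ge0 ?nm_ge0 ?(ltW s0) //.
    by apply: (le_trans (nm_triangle c _ _)); rewrite zs.
  by apply: lerXn2r; rewrite ?nnegrE ?nm_ge0 // gM.
Qed.

(** The difference quotient of [u] at [w] is differentiable off [w] and [p], is bounded near [p],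
    and tends to [l] at [w]. On the circle of radius r / 2 about [w] it is at most 2 M / (r / 2). *)
Lemma cauchy_estimate u p w l (r M : R) :
  (forall z, 0 < nm (z - p) < r -> derivable u z 1) ->
  (forall z, 0 < nm (z - p) < r -> nm (u z) <= M) ->
  0 < nm (w - p) < r / 4 -> cderiv u w l -> nm l <= 4 * M / r.
Proof.
move=> du uM /andP[wp0 wp4] ul.
have r0 : 0 < r by have := lt_trans wp0 wp4; lra.
have wr : 0 < nm (w - p) < r by rewrite wp0; lra.
have M0 : 0 <= M by apply: le_trans (uM w wr); exact: nm_ge0.
(* Since |w - p| < r / 4, the disc of radius 3 r / 4 about [w] stays within distance [r] of [p]. *)
have srho : 0 < r / 2 < 3 * r / 4 by apply/andP; split; lra.
have pw : p != w by rewrite eq_sym -subr_eq0 -nm_gt0.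
refine (mean_value_punctured (g := fun z => (u z - u w) / (z - w)) srho pw _ _ _ _ _).
- by rewrite divr_ge0 ?mulr_ge0 // ltW.
- move=> z /andP[zw zw3] zp.
  have zr : 0 < nm (z - p) < r.
    rewrite nm_gt0 subr_eq0 zp /=; apply: (le_lt_trans (nm_triangle w _ _)); lra.
  have zw0 : z - w != 0 by rewrite -nm_gt0.
  refine (@derivable_fun_div _ (fun z => u z - u w) (fun z => z - w) z zw0 _ _).
    exact (derivable_funB (du z zr) (@derivable_fun_cst _ (u w) z)).
  exact (derivable_funB (@derivable_fun_id _ z) (@derivable_fun_cst _ w z)).
- pose d := nm (w - p) / 2.
  have d0 : 0 < d by rewrite divr_gt0.
  exists d => //; exists (2 * M / d) => z /andP[zp zd].
  have zr : 0 < nm (z - p) < r by rewrite zp /=; rewrite /d in zd; lra.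
  have zw : d <= nm (z - w).
    have := nm_triangle z w p; rewrite (nm_distC w z) /d; rewrite /d in zd; lra.
  rewrite nmM nmV; apply: ler_pM; rewrite ?nm_ge0 ?invr_ge0 ?nm_ge0 //.
    by apply: (le_trans (nmB _ _)); have := uM z zr; have := uM w wr; lra.
  by rewrite lef_pV2 ?posrE // (lt_le_trans d0).
- move=> e e0; have [d d0 dP] := ul e e0; exists d => // z /andP[zw0 /dP].
  move=> le1; rewrite -(ler_pM2r zw0) -nmM mulrBl divfK // -nm_eq0 gt_eqF //.
- move=> z zs zp.
  have zr : 0 < nm (z - p) < r.
    rewrite nm_gt0 subr_eq0 zp /=; apply: (le_lt_trans (nm_triangle w _ _)); lra.
  rewrite nmM nmV zs ler_pdivrMr ?divr_gt0 //.
  have -> : 4 * M / r * (r / 2) = M + M by field; rewrite gt_eqF.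
  by apply: (le_trans (nmB _ _)); apply: lerD; exact: uM.
Qed.

Lemma eps_is_derive (f : R -> R) (x l : R) :
  (forall e : R, 0 < e -> exists2 d : R, 0 < d & forall h, `|h| < d ->
    `|f (x + h) - f x - l * h| <= e * `|h|) -> is_derive x 1 f l.
Proof.
move=> fl.
have cv : (fun h => h^-1 *: (f (h *: 1 + x) - f x)) @ 0^' --> l.
  apply/cvgrPdist_le => e e0; have [d d0 dP] := fl e e0.
  apply/nbhs_normP; exists d => // h /=; rewrite sub0r normrN => hd h0.
  have hp : 0 < `|h| by rewrite normr_gt0.
  rewrite [h *: 1]mulr1 [_ *: _]mulrC distrC (addrC h).
  by rewrite -(ler_pM2r hp) -normrM mulrBl divfK //; exact: dP.
apply: DeriveDef; first by apply/cvg_ex; exists l.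
exact: cvg_lim cv.
Qed.

(** The mean value theorem fails for complex values, so it is applied to the real part of [f] along
    the segment after a rotation making [f b - f a] positive. At the endpoint [a] only continuity is
    asked: there [f] may fail to be differentiable, as is not yet excluded for the inverse map at a
    critical value. *)
Lemma segment_lipschitz f (a b : C) (K : R) :
  (forall e : R, 0 < e -> exists2 d : R, 0 < d &
     forall z, nm (z - a) < d -> nm (f z - f a) < e) ->
  (forall t : R, 0 < t <= 1 ->
     exists2 l, cderiv f (a + (t%:C)%C * (b - a)) l & nm l <= K) ->
  nm (f b - f a) <= K * nm (b - a).
Proof.
move=> fa fd.
pose zt (t : R) : C := a + (t%:C)%C * (b - a).
have ztB (t t' : R) : zt t' - zt t = ((t' - t)%:C)%C * (b - a).
  by rewrite /zt rmorphB /=; ring.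
have nmzt t t' : nm (zt t' - zt t) = `|t' - t| * nm (b - a).
  by rewrite ztB nmM nm_real.
have zt0 : zt 0 = a by rewrite /zt mul0r addr0.
have zt1 : zt 1 = b by rewrite /zt mul1r addrC subrK.
have [ba|ba] := eqVneq b a; first by rewrite ba !subrr nm0 mulr0.
have ba0 : 0 < nm (b - a) by rewrite nm_gt0 subr_eq0.
have K0 : 0 <= K.
  have [|l _] := fd 1; first by rewrite ltr01 lexx.
  by apply: le_trans; exact: nm_ge0.
have [D0|D0] := eqVneq (f b - f a) 0.
  by rewrite D0 nm0 mulr_ge0 // ltW.
pose al : C := ((nm (f b - f a))%:C)%C / (f b - f a).
have nal : nm al = 1.
  by rewrite /al nmM nmV nm_real ger0_norm ?nm_ge0 // divff // nm_eq0.
pose h (t : R) : R := complex.Re (al * f (zt t)).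
have hB t t' : h t' - h t = complex.Re (al * (f (zt t') - f (zt t))).
  by rewrite /h -ReB mulrBr.
have E : h 1 - h 0 = nm (f b - f a).
  by rewrite hB zt0 zt1 /al divfK.
have cf (t : R) : 0 <= t <= 1 -> forall e : R, 0 < e -> exists2 d : R, 0 < d &
    forall t', `|t' - t| < d -> nm (f (zt t') - f (zt t)) < e.
  move=> /andP[t0 t1] e e0.
  have [d d0 dP] : exists2 d : R, 0 < d &
     forall z, nm (z - zt t) < d -> nm (f z - f (zt t)) < e.
    move: t0; rewrite le_eqVlt => /predU1P[<-|t0]; first by rewrite zt0; exact: fa.
    have [|l fl _] := fd t; first by rewrite t0.
    exact: cderiv_continuous fl _ e0.
  exists (d / nm (b - a)); first by rewrite divr_gt0.
  by move=> t' tt'; apply: dP; rewrite nmzt -ltr_pdivlMr.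
have ch : {within `[0, 1], continuous h}.
  have cf' t : `[0 : R, 1] t -> forall e : R, 0 < e -> exists2 d : R, 0 < d &
      forall t', `[0 : R, 1] t' -> `|t' - t| < d ->
      nm (al * f (zt t') - al * f (zt t)) < e.
    rewrite /= in_itv /= => t01 e e0; have [d d0 dP] := cf t t01 e e0.
    exists d => // t' _ /dP; by rewrite -mulrBr nmM nal mul1r.
  by have [] := within_continuous_ReIm (f := fun t => al * f (zt t)) cf'.
have /choice [L LP] : forall t : R, exists l, 0 < t <= 1 ->
    cderiv f (zt t) l /\ nm l <= K.
  move=> t; case: (pselect (0 < t <= 1)) => [/fd [l l1 l2]|N]; last by exists 0.
  by exists l.
have dh (t : R) : t \in `]0, 1[%R -> is_derive t 1 h (complex.Re (al * (L t * (b - a)))).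
  rewrite in_itv /= => /andP[t0 t1]; apply: eps_is_derive => e e0.
  have [|fl _] := LP t; first by rewrite t0 ltW.
  have [d d0 dP] := fl _ (divr_gt0 e0 ba0).
  exists (d / nm (b - a)); first by rewrite divr_gt0.
  move=> k kd.
  have /dP : nm (zt (t + k) - zt t) < d by rewrite nmzt addrC addKr -ltr_pdivlMr.
  rewrite nmzt mulrACA [t + k - t](_ : _ = k); last by rewrite addrC addKr.
  rewrite mulVf ?gt_eqF // mulr1 => le1.
  have -> : h (t + k) - h t - complex.Re (al * (L t * (b - a))) * k =
      complex.Re (al * (f (zt (t + k)) - f (zt t) - L t * (zt (t + k) - zt t))).
    rewrite hB ztB [t + k - t](_ : _ = k); last by rewrite addrC addKr.
    rewrite [in RHS]mulrBr ReB; congr (_ - _).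
    have -> : al * (L t * ((k%:C)%C * (b - a))) = (k%:C)%C * (al * (L t * (b - a))).
      by ring.
    by case: (al * _) => x y /=; ring.
  by apply: (le_trans (nm_Re _)); rewrite nmM nal mul1r.
have [t] := MVT ltr01 dh ch.
rewrite in_itv /= => /andP[t0 t1]; rewrite E subr0 mulr1 => ->.
apply: (le_trans (ler_norm _)); apply: (le_trans (nm_Re _)).
rewrite nmM nal mul1r nmM ler_pM2r //.
by have [|_] := LP t; first by rewrite t0 ltW.
Qed.

End IsolatedPoint.

(** * Critical points of injective holomorphic maps *)

Section InverseHolomorphic.
Variable R : realType.
Local Notation C := (Cplx R).
Implicit Types (z w c l m p : C) (f g u : C -> C).

(** The formula for the derivative, not just its existence, is needed to differentiate (z - p)^k
    u. *)
Lemma cderivM f g z l m : cderiv f z l -> cderiv g z m ->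
  cderiv (fun w => f w * g w) z (l * g z + f z * m).
Proof.
move=> fl gm e e0.
have e30 : 0 < e / 3 by rewrite divr_gt0.
have F0 : 0 < nm (f z) + 1 by rewrite ltr_wpDl ?nm_ge0.
have G0 : 0 < nm (g z) + 1 by rewrite ltr_wpDl ?nm_ge0.
have L0 : 0 < nm l + 1 by rewrite ltr_wpDl ?nm_ge0.
have [d1 d10 d1P] := fl _ (divr_gt0 e30 G0).
have [d2 d20 d2P] := gm _ (divr_gt0 e30 F0).
have [d3 d30 d3P] := cderiv_lipschitz fl.
have [d4 d40 d4P] := cderiv_continuous gm (divr_gt0 e30 L0).
exists (Num.min (Num.min d1 d2) (Num.min d3 d4)); first by rewrite !lt_min d10 d20 d30.
move=> w; rewrite !lt_min => /andP[/andP[/d1P h1 /d2P h2] /andP[/d3P h3 /d4P h4]].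
have -> : f w * g w - f z * g z - (l * g z + f z * m) * (w - z) =
  (f w - f z - l * (w - z)) * g z + f z * (g w - g z - m * (w - z)) +
  (f w - f z) * (g w - g z) by ring.
apply: (le_trans (nmD _ _)); rewrite [e](_ : _ = e / 3 + e / 3 + e / 3); last by field.
rewrite [leRHS]mulrDl [X in _ <= X + _]mulrDl.
apply: lerD; [apply: (le_trans (nmD _ _)); apply: lerD|].
- rewrite nmM; have := ler_pM (nm_ge0 _) (nm_ge0 (g z)) h1 (_ : _ <= nm (g z) + 1).
  by rewrite mulrAC divfK ?gt_eqF // lerDl; apply.
- rewrite nmM; have := ler_pM (nm_ge0 (f z)) (nm_ge0 _) (_ : _ <= nm (f z) + 1) h2.
  by rewrite mulrA [_ * (e / 3 / _)]mulrC divfK ?gt_eqF // lerDl; apply.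
- rewrite nmM; have := ler_pM (nm_ge0 _) (nm_ge0 _) h3 (ltW h4).
  by rewrite mulrAC [_ * (e / 3 / _)]mulrC divfK ?gt_eqF //; apply.
Qed.

Lemma cderiv_subX p n z :
  cderiv (fun w => (w - p) ^+ n) z (n%:R * (z - p) ^+ n.-1).
Proof.
elim: n => [|n IH].
  move=> e e0; exists 1 => // w _.
  by rewrite !expr0 subrr mul0r mul0r subr0 nm0 mulr_ge0 ?nm_ge0 // ltW.
have d1 : cderiv (fun w => w - p) z 1.
  move=> e e0; exists 1 => // w _.
  rewrite (_ : w - p - (z - p) - 1 * (w - z) = 0); last by ring.
  by rewrite nm0 mulr_ge0 ?nm_ge0 // ltW.
have := cderivM d1 IH.
rewrite (_ : 1 * _ + _ = n.+1%:R * (z - p) ^+ n).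
  by under eq_fun do rewrite -exprS.
case: n {IH} => [|n] /=; first by rewrite expr0 mul0r mulr0 addr0.
by rewrite !exprS -!natr1; ring.
Qed.

(** The segment from [z] to [w] meets [p] only if [w - p] is a negative multiple of [z - p]. A
    detour then costs a bounded factor, which is why the bound involves the distances to [p] instead
    of |z - w|. *)
Lemma puncturedball_lipschitz u p (d L : R) :
  (forall z, 0 < nm (z - p) < d -> exists2 l, cderiv u z l & nm l <= L) ->
  forall z w, 0 < nm (z - p) < d -> 0 < nm (w - p) < d ->
    nm (u z - u w) <= 3 * L * (nm (z - p) + nm (w - p)).
Proof.
move=> du z w zd wd.
have L0 : 0 <= L.
  by have [l _] := du z zd; apply: le_trans; exact: nm_ge0.
have /andP[z0 zd'] := zd; have /andP[w0 wd'] := wd.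
have seg (a b : C) : 0 < nm (a - p) < d -> 0 < nm (b - p) < d ->
    (forall t : R, 0 < t <= 1 -> a + (t%:C)%C * (b - a) != p) ->
    nm (u b - u a) <= L * nm (b - a).
  move=> ad bd avoid; apply: segment_lipschitz => [e e0|t t01].
    have [l ul _] := du a ad; exact: cderiv_continuous ul _ e0.
  apply: du; rewrite nm_gt0 subr_eq0 avoid //=.
  have /andP[t0 t1] := t01.
  have -> : a + (t%:C)%C * (b - a) - p =
      ((1 - t)%:C)%C * (a - p) + (t%:C)%C * (b - p).
    by rewrite rmorphB rmorph1 /=; ring.
  apply: (le_lt_trans (nmD _ _)); rewrite !nmM !nm_real.
  rewrite (gtr0_norm t0) ger0_norm ?subr_ge0 //.
  have /andP[_ ad'] := ad; have /andP[_ bd'] := bd.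
  have : (1 - t) * nm (a - p) <= (1 - t) * d.
    by rewrite ler_wpM2l ?subr_ge0 // ltW.
  have : t * nm (b - p) < t * d by rewrite ltr_pM2l.
  lra.
have zp : z - p != 0 by rewrite -nm_gt0.
have wp : w - p != 0 by rewrite -nm_gt0.
case: (pselect (exists2 s : R, 0 < s & w - p = - (s%:C)%C * (z - p))) => [[s s0 ws]|N].
  (* A quarter turn of [z] about [p]. Relative to [z - p], the points of the two new segments have
     coefficients t + (1 - t) i and t i - (1 - t) s, which are nonzero because their real,
     respectively imaginary, part is t > 0. *)
  pose m : C := p + 'i%C * (z - p).
  have mp : m - p = 'i%C * (z - p) by rewrite /m addrC addKr.
  have ni : nm ('i%C : C) = 1 by rewrite nm_sqrt /= expr0n /= add0r expr1n sqrtr1.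
  have md : 0 < nm (m - p) < d by rewrite mp nmM ni mul1r.
  have s1 : nm (u z - u m) <= L * nm (z - m).
    apply: seg => // t /andP[t0 t1]; rewrite -subr_eq0.
    have -> : m + (t%:C)%C * (z - m) - p =
        ((t%:C)%C + ((1 - t)%:C)%C * 'i%C) * (z - p).
      by rewrite /m rmorphB rmorph1 /=; ring.
    rewrite mulf_neq0 //; apply/eqP => /(congr1 (@complex.Re R)) /=.
    rewrite mulr0 mul0r subrr addr0 => tE; by rewrite tE ltxx in t0.
  have s2 : nm (u m - u w) <= L * nm (m - w).
    apply: seg => // t /andP[t0 t1]; rewrite -subr_eq0.
    have -> : w + (t%:C)%C * (m - w) - p =
        ((t%:C)%C * 'i%C - ((1 - t)%:C)%C * (s%:C)%C) * (z - p).
      have -> : w = p + (w - p) by ring.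
      by rewrite ws /m rmorphB rmorph1 /=; ring.
    rewrite mulf_neq0 //; apply/eqP => /(congr1 (@complex.Im R)) /=.
    rewrite !mulr0 !mul0r !mulr1 !addr0 oppr0 addr0 => tE.
    by rewrite tE ltxx in t0.
  apply: (le_trans (nm_triangle (u m) _ _)).
  apply: (le_trans (lerD s1 s2)); rewrite -mulrDr.
  rewrite [3 * L]mulrC -mulrA ler_wpM2l //.
  have := nm_triangle p z m; have := nm_triangle p m w.
  rewrite (nm_distC p w) (nm_distC p m) mp nmM ni mul1r; lra.
have := seg z w zd wd; rewrite (nm_distC (u w)) => /(_ _)/le_trans; apply.
  move=> t /andP[t0 t1]; apply/eqP => E.
  have tc : (t%:C)%C != 0 :> C by rewrite -nm_gt0 nm_real normr_gt0 gt_eqF.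
  have E' : (t%:C)%C * (w - p) = - ((1 - t)%:C)%C * (z - p).
    have -> : (t%:C)%C * (w - p) = z + (t%:C)%C * (w - z) - p -
        ((1 - t)%:C)%C * (z - p) by rewrite rmorphB rmorph1 /=; ring.
    by rewrite E subrr sub0r mulNr.
  move: t1; rewrite le_eqVlt => /predU1P[t1|t1].
    move: E'; rewrite t1 subrr rmorph1 mul1r oppr0 mul0r => E'.
    by rewrite E' eqxx in wp.
  apply: N; exists ((1 - t) / t); first by rewrite divr_gt0 // subr_gt0.
  apply: (mulfI tc); rewrite E' mulrA; congr (_ * _).
  by rewrite mulrN; congr (- _); rewrite -rmorphM /= mulrC divfK ?gt_eqF.
have := nm_triangle p w z; rewrite (nm_distC p z) => tr.
rewrite [3 * L]mulrC -mulrA ler_wpM2l //; lra.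
Qed.

End InverseHolomorphic.

(** * Orders of zeros and differentiability of the inverse *)

Section ConformalInverse.
Variable R : realType.
Local Notation C := (Cplx R).
Implicit Types (z w c l m p : C) (f g u : C -> C).

Definition punctured_bounded u p := exists2 d : R, 0 < d & exists K : R,
  forall z, 0 < nm (z - p) < d -> nm (u z) <= K.

Lemma derivable_div_subX f p k z : z != p -> derivable f z 1 ->
  derivable (fun w => f w / (w - p) ^+ k) z 1.
Proof.
move=> zp df.
have zk : (z - p) ^+ k != 0 by rewrite expf_neq0 // subr_eq0.
exact (@derivable_fun_div _ f (fun w => (w - p) ^+ k) z zk df
  (cderiv_derivable (cderiv_subX p k z))).
Qed.

Lemma nm_ball_point p (e : R) : 0 < e -> exists w : C, nm (w - p) = e.
Proof.
move=> e0; exists (p + (e%:C)%C).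
by rewrite addrC addKr nm_real gtr0_norm.
Qed.

(** If every quotient were bounded near [p], the mean value inequality around a nearby point [w]
    would give |f w| <= M / 2^k for all k, hence [f w = 0]. *)
Lemma finite_order f p (r : R) : 0 < r ->
  (forall z, nm (z - p) < r -> derivable f z 1) ->
  (forall z, 0 < nm (z - p) < r -> f z != 0) ->
  ~ (forall k, punctured_bounded (fun z => f z / (z - p) ^+ k) p).
Proof.
move=> r0 df fn0 Bnd.
have [|d1 d10 d1P] := derivable_continuous_nm (df p _) ltr01.
  by rewrite subrr nm0.
pose s := Num.min r d1; pose M := nm (f p) + 1.
have s0 : 0 < s by rewrite lt_min r0.
have sr z : nm (z - p) < s -> nm (z - p) < r by rewrite lt_min => /andP[].
have sM z : nm (z - p) < s -> nm (f z) <= M.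
  rewrite lt_min => /andP[_ /d1P] h; rewrite /M addrC -lerBlDr.
  by apply: le_trans (ltW h); exact: nm_subr_ge.
have M0 : 0 <= M by rewrite addr_ge0 ?nm_ge0.
clearbody s M.
(* With |w - p| = s / 8, the circle of radius s / 2 about [w] stays at distance at least s / 4 from
   [p]; the quotient of s / 8 and s / 4 is the ratio 1 / 2. *)
have [w ws] := nm_ball_point p (divr_gt0 s0 (ltr0Sn _ 7)).
have wp0 : 0 < nm (w - p) by rewrite ws divr_gt0.
have wps : nm (w - p) < s by rewrite ws; lra.
have bound k : nm (f w) <= M * (1 / 2) ^+ k.
  pose g z : C := f z / (z - p) ^+ k.
  have srho : 0 < s / 2 < 3 * s / 4 by apply/andP; split; lra.
  have pw : p != w by rewrite eq_sym -subr_eq0 -nm_gt0.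
  have : nm (g w) <= M / (s / 4) ^+ k.
    refine (mean_value_punctured (g := g) srho pw _ _ (Bnd k) _ _).
    - by rewrite divr_ge0 // exprn_ge0 // divr_ge0 // ltW.
    - move=> z /andP[zw zw3] zp; apply: (derivable_div_subX zp); apply: df.
      apply: sr; apply: (le_lt_trans (nm_triangle w _ _)); rewrite ws; lra.
    - apply: derivable_punctured_lim; apply: derivable_div_subX.
        by rewrite -subr_eq0 -nm_gt0.
      by apply: df; exact: sr.
    - move=> z zs zp; rewrite /g nmM nmV nmX.
      have h1 : s / 4 <= nm (z - p).
        have := nm_triangle p z w; rewrite zs (nm_distC p w) ws; lra.
      apply: ler_pM; rewrite ?invr_ge0 ?exprn_ge0 ?nm_ge0 //.
        by apply: sM; apply: (le_lt_trans (nm_triangle w _ _)); rewrite zs ws; lra.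
      rewrite lef_pV2 ?posrE ?exprn_gt0 ?nm_gt0 ?subr_eq0 ?divr_gt0 //.
      by apply: lerXn2r; rewrite ?nnegrE ?nm_ge0 ?divr_ge0 ?(ltW s0).
  rewrite /g nmM nmV nmX ler_pdivrMr ?exprn_gt0 // -mulrA -exprVn -exprMn ws.
  by have -> : (s / 4)^-1 * (s / 8) = 1 / 2 by field; rewrite gt_eqF.
have : nm (f w) <= 0.
  have lim0 : (fun n => M * (1 / 2) ^+ n) @ \oo --> (M * 0 : R).
    by apply: cvgMr; apply: cvg_expr; rewrite ger0_norm ?divr_ge0 //; lra.
  rewrite -(mulr0 M); apply: (cvgr_to_ge lim0); exact: nearW.
have : 0 < nm (f w) by rewrite nm_gt0 fn0 // wp0 /= sr.
by case: ltgtP.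
Qed.

(** With k the order of the zero, f = (z - p)^k u and f' = (z - p)^(k-1) (k u + (z - p) u'). Near
    [p] the modulus of [u] is bounded below and u' is bounded, so the second factor cannot
    vanish. *)
Lemma critical_points_isolated f p (r : R) : 0 < r ->
  (forall z, nm (z - p) < r -> derivable f z 1) -> f p = 0 ->
  (forall z, 0 < nm (z - p) < r -> f z != 0) ->
  exists2 d : R, 0 < d & forall z, 0 < nm (z - p) < d -> ~ cderiv f z 0.
Proof.
move=> r0 df fp fn0.
pose u k (z : C) : C := f z / (z - p) ^+ k.
(* [f p = 0] starts the search at exponent 1. A positive k is essential at the end, where the factor
   [k%:R] must have modulus at least 1. *)
have B1 : punctured_bounded (u 1%N) p.
  have [|l fl] := (cderivP f p).1 (df p _); first by rewrite subrr nm0.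
  have [d d0 dP] := cderiv_lipschitz fl.
  exists d => //; exists (nm l + 1) => z /andP[z0 zd].
  rewrite /u expr1 nmM nmV ler_pdivrMr //.
  by have := dP z zd; rewrite fp subr0.
have [k [k0 Bk nBk]] : exists k, [/\ (0 < k)%N, punctured_bounded (u k) p &
    ~ punctured_bounded (u k.+1) p].
  apply: contrapT => N; apply: (finite_order r0 df fn0).
  have all1 k : punctured_bounded (u k.+1) p.
    elim: k => // k IH; apply: contrapT => nB; apply: N.
    by exists k.+1.
  case=> [|k]; last exact: all1.
  have [d d0 [K KP]] := B1.
  exists (Num.min d 1); first by rewrite lt_min d0 ltr01.
  exists K => z /andP[z0]; rewrite lt_min => /andP[zd z1].
  have := KP z; rewrite z0 zd => /(_ isT); apply: le_trans.
  rewrite /u expr0 expr1 !nmM !nmV nm1 invr1 mulr1 ler_pdivlMr //.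
  by rewrite ler_piMr ?nm_ge0 // ltW.
have [d0 d00 [K KP]] := Bk.
pose d := Num.min d0 r.
have dpos : 0 < d by rewrite lt_min d00.
have dd0 z : 0 < nm (z - p) < d -> nm (u k z) <= K.
  by move=> /andP[z0]; rewrite lt_min => /andP[zd _]; apply: KP; rewrite z0.
have dr z : 0 < nm (z - p) < d -> derivable (u k) z 1.
  move=> /andP[z0]; rewrite lt_min => /andP[_ zr].
  by apply: derivable_div_subX; [rewrite -subr_eq0 -nm_gt0|exact: df].
have drf z : 0 < nm (z - p) < d -> nm (z - p) < r.
  by move=> /andP[z0]; rewrite lt_min => /andP[_ zr].
clearbody d.
pose L := 4 * K / d.
have uL z : 0 < nm (z - p) < d / 4 -> exists2 l, cderiv (u k) z l & nm l <= L.
  move=> zd; have /andP[z0 zd4] := zd.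
  have [|l ul] := (cderivP (u k) z).1 (dr z _); first by rewrite z0 /=; lra.
  by exists l => //; exact: (cauchy_estimate dr dd0 zd).
have lip := puncturedball_lipschitz uL.
have L0 : 0 <= L.
  have [w ws] := nm_ball_point p (divr_gt0 dpos (ltr0Sn _ 7)).
  have [|l _] := uL w; first by rewrite ws; apply/andP; split; lra.
  by apply: le_trans; exact: nm_ge0.
clearbody L.
(* Otherwise [u k] takes arbitrarily small values arbitrarily near [p]; the Lipschitz bound then
   gives |u k z| <= 3 L |z - p|, and k + 1 would also be admissible. *)
have [c0 c00 [e0 e00 cP]] : exists2 c0 : R, 0 < c0 & exists2 e0 : R, 0 < e0 &
    forall z, 0 < nm (z - p) < e0 -> c0 <= nm (u k z).
  apply: contrapT => N; apply: nBk.
  exists (d / 4); first by rewrite divr_gt0.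
  exists (3 * L) => z zd; have /andP[z0 zd4] := zd.
  have -> : u k.+1 z = u k z / (z - p) by rewrite /u exprS invfM; ring.
  rewrite nmM nmV ler_pdivrMr //; apply/ler_addgt0Pl => e epos.
  pose t := Num.min (d / 4) (e / (1 + 3 * L)).
  have L30 : 0 < 1 + 3 * L by lra.
  have t0 : 0 < t by rewrite lt_min !divr_gt0.
  have [w wt uw] : exists2 w, 0 < nm (w - p) < t & nm (u k w) < t.
    apply: contrapT => N'; apply: N; exists t => //; exists t => // w wt.
    by rewrite leNgt; apply/negP => uw; apply: N'; exists w.
  have /andP[w0 wt'] := wt.
  have wd : 0 < nm (w - p) < d / 4.
    by rewrite w0 /= (lt_le_trans wt') // ge_min lexx.
  have te : t * (1 + 3 * L) <= e by rewrite -ler_pdivlMr // ge_min lexx orbT.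
  have := lip z w zd wd.
  have := nm_subr_ge (u k z) (u k w).
  have : 3 * L * nm (w - p) <= 3 * L * t by rewrite ler_wpM2l ?mulr_ge0 // ltW.
  clearbody t; nra.
exists (Num.min (Num.min e0 (d / 4)) (c0 / (L + 1))).
  by rewrite !lt_min e00 !divr_gt0 // ltr_wpDl.
move=> z /andP[z0]; rewrite !lt_min => /andP[/andP[ze zd] zc] fz.
have [|l ul lL] := uL z; first by rewrite z0.
have f' := cderivM (cderiv_subX p k z) ul.
have zp : z - p != 0 by rewrite -nm_gt0.
have f'' : cderiv f z (k%:R * (z - p) ^+ k.-1 * u k z + (z - p) ^+ k * l).
  (* The factorization of [f] holds off [p]; the ball of radius |z - p| about [z] avoids it. *)
  apply: (@cderiv_near _ _ _ _ _ (nm (z - p)) z0 _ f') => w wz.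
  rewrite /u mulrC divfK // expf_neq0 // subr_eq0; apply/eqP => wp.
  by rewrite wp nm_distC ltxx in wz.
have := cderiv_unique fz f''.
move: k0 (cP z); rewrite z0 ze => k0 /(_ isT) cu.
rewrite -[in (z - p) ^+ k](prednK k0) exprS => E.
have E2 : k%:R * u k z = - ((z - p) * l).
  apply: (mulfI (expf_neq0 k.-1 zp)); apply/eqP.
  rewrite mulrN -addr_eq0 [X in _ == X]E; apply/eqP; ring.
have : nm (k%:R * u k z) = nm ((z - p) * l) by rewrite E2 nmN.
rewrite nmM [in RHS]nmM => E3.
have k1 : 1 <= nm (k%:R : C).
  have -> : (k%:R : C) = ((k%:R : R)%:C)%C by rewrite rmorph_nat.
  by rewrite nm_real ger0_norm ?ler0n // ler1n.
have : nm (z - p) * nm l < c0.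
  apply: (@le_lt_trans _ _ (nm (z - p) * (L + 1))).
    by rewrite ler_pM2l // (le_trans lL) // lerDl.
  by rewrite -ltr_pdivlMr // ltr_wpDl.
rewrite -E3 ltNge => /negP; apply.
apply: (le_trans cu); rewrite ler_peMl ?nm_ge0 //.
Qed.

Lemma inverse_cderiv (phi psi : C -> C) z l (r : R) : 0 < r ->
  cderiv phi z l -> l != 0 -> psi (phi z) = z ->
  (forall w, nm (w - phi z) < r -> phi (psi w) = w) ->
  (forall e : R, 0 < e -> exists2 d : R, 0 < d &
     forall w, nm (w - phi z) < d -> nm (psi w - psi (phi z)) < e) ->
  cderiv psi (phi z) l^-1.
Proof.
move=> r0 phil l0 psiz phiK cpsi e e0.
have nl : 0 < nm l by rewrite nm_gt0.
(* The first bound gives |psi w - z| <= (2 / |l|) |w - phi z|; the second turns the error of [phi]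
   into at most [e] times |w - phi z| after division by [l]. *)
pose t := Num.min (nm l / 2) (e * nm l ^+ 2 / 2).
have t0 : 0 < t by rewrite lt_min !divr_gt0 // mulr_gt0 // exprn_gt0.
have tl : t <= nm l / 2 by rewrite ge_min lexx.
have te : t <= e * nm l ^+ 2 / 2 by rewrite ge_min lexx orbT.
clearbody t.
have [d1 d10 d1P] := phil t t0.
have [d2 d20 d2P] := cpsi d1 d10.
exists (Num.min r d2); first by rewrite lt_min r0.
move=> w; rewrite lt_min => /andP[/phiK phw /d2P]; rewrite psiz => /d1P.
rewrite phw; set h := psi w - z => le1.
have le2 : nm h * (nm l / 2) <= nm (w - phi z).
  have := nm_subr_ge (l * h) (l * h - (w - phi z)).
  have -> : l * h - (l * h - (w - phi z)) = w - phi z by ring.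
  rewrite (nm_distC (l * h) (w - phi z)) nmM.
  have : t * nm h <= nm l / 2 * nm h by rewrite ler_wpM2r ?nm_ge0.
  lra.
have -> : h - l^-1 * (w - phi z) = - (l^-1 * (w - phi z - l * h)).
  by field.
rewrite nmN nmM nmV mulrC ler_pdivrMr //; apply: (le_trans le1).
apply: (@le_trans _ _ (e * nm l ^+ 2 / 2 * nm h)); first by rewrite ler_wpM2r ?nm_ge0.
have -> : e * nm l ^+ 2 / 2 * nm h = e * nm l * (nm h * (nm l / 2)) by field.
rewrite [leRHS]mulrAC ler_pM2l //; exact: mulr_gt0.
Qed.

Lemma injective_deriv_neq0 (phi psi : C -> C) z0 l (r s : R) : 0 < r -> 0 < s ->
  (forall z, nm (z - z0) < r -> derivable phi z 1) ->
  (forall z, nm (z - z0) < r -> psi (phi z) = z) ->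
  (forall w, nm (w - phi z0) < s -> phi (psi w) = w /\
     forall e : R, 0 < e -> exists2 d : R, 0 < d &
     forall w', nm (w' - w) < d -> nm (psi w' - psi w) < e) ->
  cderiv phi z0 l -> l != 0.
Proof.
move=> r0 s0 dphi psiK phiK phil; apply/eqP => l0; rewrite {}l0 in phil.
have z0r : nm (z0 - z0) < r by rewrite subrr nm0.
have psi0 : psi (phi z0) = z0 by exact: psiK.
pose w0 := phi z0.
have [d1 d10 d1P] : exists2 d : R, 0 < d & forall z, 0 < nm (z - z0) < d ->
    ~ cderiv (fun z => phi z - w0) z 0.
  apply: (critical_points_isolated r0).
  - move=> z /dphi dz; exact (derivable_funB dz (@derivable_fun_cst _ w0 z)).
  - by rewrite subrr.
  - move=> z /andP[zz0 zr]; rewrite subr_eq0; apply/eqP => E.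
    have zE : z = z0 by rewrite -(psiK z zr) E psi0.
    by rewrite zE subrr nm0 ltxx in zz0.
have [|_ cpsi0] := phiK w0; first by rewrite subrr nm0.
pose d := Num.min r d1.
have d0 : 0 < d by rewrite lt_min r0.
have [d2 d20 d2P] := cpsi0 d d0.
pose q := Num.min s d2.
have q0 : 0 < q by rewrite lt_min s0.
have qs w : nm (w - w0) < q -> nm (w - w0) < s by rewrite lt_min => /andP[].
have qd w : nm (w - w0) < q -> nm (psi w - z0) < d.
  by rewrite lt_min => /andP[_ /d2P]; rewrite psi0.
clearbody q.
have dpsi w : 0 < nm (w - w0) < q -> exists m, cderiv psi w m.
  move=> /andP[w0' wq].
  have [phw cw] := phiK w (qs w wq).
  have := qd w wq; rewrite lt_min => /andP[pr pd].
  have [m phim] := (cderivP phi _).1 (dphi _ pr).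
  (* [psi w] is near [z0] but differs from it, so it is not a critical point. *)
  have m0 : m != 0.
    apply/eqP => mE; apply: (d1P (psi w)).
      rewrite pd andbT nm_gt0 subr_eq0; apply/eqP => E.
      by move: w0'; rewrite -phw E subrr nm0 ltxx.
    rewrite -mE => e e0; have [d' d'0 d'P] := phim e e0; exists d' => // v /d'P.
    by rewrite (_ : phi v - w0 - _ = phi v - phi (psi w)) //; ring.
  exists m^-1; rewrite -phw; apply: (@inverse_cderiv _ _ _ _ (q - nm (w - w0))) => //.
  - by rewrite subr_gt0.
  - by rewrite phw.
  - rewrite phw => v vw; have [] // := phiK v; apply: qs.
    by apply: (le_lt_trans (nm_triangle w _ _)); lra.
  - by rewrite phw.
pose M := nm z0 + d.
have psiM w : 0 < nm (w - w0) < q -> nm (psi w) <= M.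
  move=> /andP[_ /qd h]; have -> : psi w = z0 + (psi w - z0) by ring.
  by apply: (le_trans (nmD _ _)); rewrite lerD2l ltW.
pose L := 4 * M / q.
have L0 : 0 <= L by rewrite divr_ge0 ?mulr_ge0 ?addr_ge0 ?nm_ge0 // ltW.
have psiL w : nm (w - w0) < q / 4 -> nm (psi w - z0) <= L * nm (w - w0).
  move=> wq; have [->|ww0] := eqVneq w w0.
    by rewrite psi0 !subrr nm0 mulr0.
  rewrite -psi0; apply: segment_lipschitz => // t /andP[t0 t1].
  set v := w0 + _.
  have vw : nm (v - w0) = t * nm (w - w0).
    by rewrite /v addrC addKr nmM nm_real gtr0_norm.
  have ww : 0 < nm (w - w0) by rewrite nm_gt0 subr_eq0.
  have vq : 0 < nm (v - w0) < q / 4.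
    rewrite vw mulr_gt0 //=; apply: le_lt_trans wq.
    by rewrite ler_piMl // nm_ge0.
  have [|m pm] := dpsi v; first by have /andP[-> vq4] := vq; rewrite /=; lra.
  exists m => //; apply: (@cauchy_estimate _ psi w0 v m q M) => // z zq.
  by have [m' /cderiv_derivable] := dpsi z zq.
(* Smallness 1 / (2 (L + 1)) for the derivative of [phi] against the Lipschitz constant [L] of [psi]
   yields |z - z0| <= |z - z0| / 2 at a point [z] different from [z0]. *)
have L10 : 0 < 2 * (L + 1) by rewrite mulr_gt0 // ltr_wpDl.
have [d3 d30 d3P] := phil _ (divr_gt0 ltr01 L10).
have [d4 d40 d4P] := cderiv_continuous phil (divr_gt0 q0 (ltr0Sn _ 3)).
pose t := Num.min r (Num.min d3 d4) / 2.
have t0 : 0 < t by rewrite divr_gt0 // !lt_min r0 d30.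
have : t < Num.min r (Num.min d3 d4).
  by rewrite /t ltr_pdivrMr // ltr_pMr ?ltr1n // !lt_min r0 d30.
rewrite !lt_min => /and3P[tr td3 td4].
have [z zt] := nm_ball_point z0 t0.
have := d3P z; rewrite zt => /(_ td3); rewrite mul0r subr0 => le1.
have le2 : nm (phi z - phi z0) < q / 4 by apply: d4P; rewrite zt.
have := psiL _ le2; rewrite psiK ?zt // => le3.
have : L * nm (phi z - phi z0) <= L * (1 / (2 * (L + 1)) * t).
  by rewrite ler_wpM2l.
have -> : L * (1 / (2 * (L + 1)) * t) = L / (L + 1) * (t / 2).
  by field; rewrite gt_eqF // ltr_wpDl.
have : L / (L + 1) * (t / 2) <= t / 2.
  apply: ler_piMl; first by rewrite divr_ge0 // ltW.
  by rewrite ler_pdivrMr ?ltr_wpDl // mul1r lerDl.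
rewrite -/w0 in le3 *; lra.
Qed.

End ConformalInverse.

(** * Jordan domains and their Riemann maps *)

Section Circle.
Variable R : realType.
Local Notation C := (Cplx R).
Implicit Types (z w : C) (x y t : R).

Lemma expiD x y : expi (x + y) = expi x * expi y.
Proof.
rewrite /expi cosD sinD; apply/eqP; rewrite eq_complex /= eqxx /= addrC.
by rewrite (mulrC (sin x)).
Qed.

Lemma nm_expi x : nm (expi x) = 1.
Proof. by rewrite nm_sqrt /= cos2Dsin2 sqrtr1. Qed.

Lemma expiX x n : expi x ^+ n = expi (n%:R * x).
Proof.
elim: n => [|n IH]; first by rewrite expr0 mul0r /expi cos0 sin0.
by rewrite exprS IH -expiD -nat1r mulrDl mul1r.
Qed.

Lemma closed_disc_expi x : closed_disc (expi x).
Proof. by rewrite /closed_disc /= nmE nm_expi. Qed.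

Lemma expi_continuous : continuous (@expi R : R -> C).
Proof.
move=> x P /nbhs_nmP [e e0 eP].
have e20 : 0 < e / 2 by rewrite divr_gt0.
have /cvgrPdist_lt /(_ _ e20) c1 := @continuous_cos R x.
have /cvgrPdist_lt /(_ _ e20) c2 := @continuous_sin R x.
rewrite nbhs_simpl /=; near=> y; apply: eP.
apply: (le_lt_trans (nm_le_ReIm _)); rewrite /= [e]splitr; apply: ltrD.
  by rewrite distrC; near: y.
by rewrite distrC; near: y.
Unshelve. all: by end_near. Qed.

Lemma unit_circle_polar z : nm z = 1 -> exists2 t, -pi <= t <= pi & expi t = z.
Proof.
case: z => a b; rewrite nm_sqrt /= => ab1.
have ab : a ^+ 2 + b ^+ 2 = 1.
  have ab0 : 0 <= a ^+ 2 + b ^+ 2 by rewrite addr_ge0 ?sqr_ge0.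
  by rewrite -(sqr_sqrtr ab0) ab1 expr1n.
have a1 : -1 <= a <= 1.
  rewrite -ler_norml -(ler_pXn2r (n := 2)) ?nnegrE // expr1n.
  by rewrite real_normK ?num_real // -ab lerDl sqr_ge0.
have [/andP[h0 hpi] ca] := acos_def a1.
have sa : sin (acos a) = `|b|.
  by rewrite sin_acos // -ab addrC addKr sqrtr_sqr.
have pi0 := pi_ge0 R.
case: (leP 0 b) => b0.
  exists (acos a); first by rewrite hpi andbT; lra.
  by rewrite /expi ca sa ger0_norm.
exists (- acos a); first by apply/andP; split; lra.
by rewrite /expi cosN sinN ca sa ltr0_norm // opprK.
Qed.

Lemma unit_circle_compact : compact (@unit_circle R).
Proof.
have -> : @unit_circle R = @expi R @` `[- pi, pi].
  apply/seteqP; split=> [z|_ [t _ <-]].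
    rewrite /unit_circle /= nmE => /(@complexI R) /unit_circle_polar[t tpi <-].
    by exists t.
  by rewrite /unit_circle /= nmE nm_expi.
apply: continuous_compact; last exact: segment_compact.
by apply: continuous_subspaceT; exact: expi_continuous.
Qed.

(** Moves an angle into a compact interval. The shift [y] is included because the later estimates
    compare the values at [th] and [th + h]. *)
Lemma expi_reduce x : exists2 t, -pi <= t <= pi &
  forall y, expi (t + y) = expi (x + y) :> C.
Proof.
have [t tpi tx] := unit_circle_polar (nm_expi x).
by exists t => // y; rewrite !expiD tx.
Qed.

(** The segment from [w] to a point of a small ball is connected and stays in [A]. *)
Lemma open_component (A : set C) (x w : C) : open A ->
  connected_component A x w ->
  exists2 r : R, 0 < r & forall v, nm (v - w) < r -> connected_component A x v.
Proof.
move=> oA Aw.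
have /nbhs_nmP [r r0 rP] : nbhs w A.
  by apply: open_nbhs_nbhs; split=> //; exact: connected_component_sub Aw.
exists r => // v vw; apply: (connected_component_trans Aw).
pose zt (t : R) : C := w + (t%:C)%C * (v - w).
have ztc : continuous zt.
  move=> t P /nbhs_nmP [e e0 eP]; rewrite nbhs_simpl /=.
  have d0 : 0 < e / (nm (v - w) + 1) by rewrite divr_gt0 // ltr_wpDl ?nm_ge0.
  apply/nbhs_normP; exists (e / (nm (v - w) + 1)) => //= s /= ts; apply: eP.
  have -> : zt s - zt t = ((s - t)%:C)%C * (v - w) by rewrite /zt rmorphB /=; ring.
  rewrite nmM nm_real distrC.
  apply: (@le_lt_trans _ _ (`|t - s| * (nm (v - w) + 1))).
    by rewrite ler_wpM2l // lerDl.
  by rewrite -ltr_pdivlMr // ltr_wpDl ?nm_ge0.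
exists (zt @` `[0, 1]); last first.
  by exists 1; rewrite /= ?in_itv /= ?ler01 ?lexx // /zt mul1r addrC subrK.
split.
- by exists 0; rewrite /= ?in_itv /= ?ler01 ?lexx // /zt mul0r addr0.
- move=> v' [t /=]; rewrite in_itv /= => /andP[t0 t1] <-; apply: rP.
  rewrite /zt addrC addKr nmM nm_real ger0_norm //.
  by apply: le_lt_trans vw; rewrite ler_piMl ?nm_ge0.
- apply: connected_continuous_connected; first exact: segment_connected.
  exact: continuous_subspaceT.
Qed.

Lemma jordan_domain_open (Om : set C) w : jordan_domain Om -> Om w ->
  exists2 r : R, 0 < r & forall v, nm (v - w) < r -> Om v.
Proof.
move=> [G [[gam [cgam [_ GE]]] [x [_ [-> _]]]]].
apply: open_component; rewrite openC GE.
apply: compact_closed; first exact: norm_hausdorff.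
by apply: continuous_compact => //; exact: unit_circle_compact.
Qed.

End Circle.

(** * Holomorphy of the inverse Riemann map *)

Section RiemannInverse.
Variable R : realType.
Local Notation C := (Cplx R).

Lemma inverse_holomorphic (Om : set C) (phi psi : C -> C) :
  (forall w, Om w -> exists2 r : R, 0 < r & forall v, nm (v - w) < r -> Om v) ->
  {within closure Om, continuous psi} ->
  (forall z, closed_disc z -> closure Om (phi z) /\ psi (phi z) = z) ->
  (forall w, closure Om w -> closed_disc (psi w) /\ phi (psi w) = w) ->
  phi @` (@open_disc R) = Om -> holomorphic_on phi (@open_disc R) ->
  holomorphic_on psi Om.
Proof.
move=> oOm cpsi phiP psiP phiE hphi w Omw.
have : (phi @` (@open_disc R)) w by rewrite phiE.
move=> [z0 z0D z0w].
have nz0 : nm z0 < 1 by move: z0D; rewrite /open_disc /= nmE ltcR.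
have r0 : 0 < 1 - nm z0 by rewrite subr_gt0.
have inD z : nm (z - z0) < 1 - nm z0 -> open_disc z.
  move=> h; rewrite /open_disc /= nmE ltcR.
  by have := nm_subr_ge z z0; lra.
have sub : Om `<=` closure Om by exact: subset_closure.
have clD z : open_disc z -> closed_disc z.
  by rewrite /open_disc /closed_disc /=; exact: ltW.
have [s s0 sP] := oOm w Omw.
have cont v : Om v -> forall e : R, 0 < e -> exists2 d : R, 0 < d &
     forall v', nm (v' - v) < d -> nm (psi v' - psi v) < e.
  move=> Omv e e0.
  have [d d0 dP] := (within_continuous_nmP _ _).1 cpsi v (sub _ Omv) e e0.
  have [s' s'0 s'P] := oOm v Omv.
  exists (Num.min d s'); first by rewrite lt_min d0.
  move=> v'; rewrite lt_min => /andP[v'd /s'P Omv'].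
  by apply: dP => //; exact: sub.
have [l phil] := (cderivP phi z0).1 (hphi z0 z0D).
have psiK z : nm (z - z0) < 1 - nm z0 -> psi (phi z) = z.
  by move=> /inD/clD/phiP[].
have l0 : l != 0.
  apply: (injective_deriv_neq0 r0 s0 _ psiK _ phil) => [z /inD|v].
    exact: hphi.
  rewrite z0w => /sP Omv; split; last exact: cont.
  by have [] := psiP v (sub _ Omv).
rewrite -z0w; apply: (@cderiv_derivable _ psi _ l^-1).
apply: (inverse_cderiv s0 phil l0).
- by apply: psiK; rewrite subrr nm0.
- by rewrite z0w => v /sP /sub /psiP [].
- by rewrite z0w; exact: cont.
Qed.

End RiemannInverse.

(** * Completeness of the disc algebra *)

Section Completeness.
Variable R : realType.
Local Notation C := (Cplx R).
Implicit Types (z w l : C) (f g u : C -> C) (e : nat -> R).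

Lemma halving_small e : (forall n, 0 <= e n) -> (forall n, e n.+1 <= e n / 2) ->
  forall (c : R), 0 < c -> exists n, e n < c.
Proof.
move=> e0 eS c c0.
have le n : e n <= e 0%N / 2 ^+ n.
  elim: n => [|n IH]; first by rewrite expr0 divr1.
  apply: (le_trans (eS n)); rewrite exprS invfM mulrA mulrAC.
  by rewrite ler_pM2r // invr_gt0.
pose N := (Num.truncn (e 0%N / c)).+1.
exists N; apply: (le_lt_trans (le N)).
rewrite ltr_pdivrMr ?exprn_gt0 // mulrC -ltr_pdivrMr //.
have : e 0%N / c < N%:R by rewrite truncnS_gt.
by move/lt_trans; apply; rewrite -natrX ltr_nat ltn_expl.
Qed.

(** Since 2 e(n+1) <= e(n), the intervals of radius 2 e(n) about x(n) are nested. An explicit rate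
    is obtained along with the limit; the complex case adds the rates of the two coordinates. *)
Lemma real_halving_limit (x : nat -> R) e :
  (forall n, 0 <= e n) -> (forall n, e n.+1 <= e n / 2) ->
  (forall n, `|x n.+1 - x n| <= e n) ->
  exists y, forall n, `|y - x n| <= 2 * e n.
Proof.
move=> e0 eS xS.
have [||n|y yP] := @nested_intervals _ (fun n => x n - 2 * e n)
    (fun n => x n + 2 * e n).
- by move=> n; have := xS n; rewrite ler_norml => /andP[]; have := eS n; lra.
- by move=> n; have := xS n; rewrite ler_norml => /andP[]; have := eS n; lra.
- by have := e0 n; lra.
exists y => n; have /andP[] := yP n; rewrite ler_norml => h1 h2.
by apply/andP; split; lra.
Qed.

Lemma halving_limit (x : nat -> C) e :
  (forall n, 0 <= e n) -> (forall n, e n.+1 <= e n / 2) ->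
  (forall n, nm (x n.+1 - x n) <= e n) ->
  exists y, forall n, nm (y - x n) <= 4 * e n.
Proof.
move=> e0 eS xS.
have [a aP] : exists a, forall n, `|a - complex.Re (x n)| <= 2 * e n.
  apply: real_halving_limit => // n.
  by rewrite -ReB; exact: le_trans (nm_Re _) (xS n).
have [b bP] : exists b, forall n, `|b - complex.Im (x n)| <= 2 * e n.
  apply: real_halving_limit => // n.
  by rewrite -ImB; exact: le_trans (nm_Im _) (xS n).
exists (Complex a b) => n; apply: (le_trans (nm_le_ReIm _)).
rewrite ReB ImB /=; have := aP n; have := bP n; lra.
Qed.

Lemma halving_limit_unique (x : nat -> C) e (y y' : C) (c c' : R) :
  (forall n, 0 <= e n) -> (forall n, e n.+1 <= e n / 2) ->
  (forall n, nm (y - x n) <= c * e n) ->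
  (forall n, nm (y' - x n) <= c' * e n) -> y = y'.
Proof.
move=> e0 eS yP y'P; apply/eqP; rewrite -subr_eq0 -nm_eq0; apply/eqP/le_anti.
rewrite nm_ge0 andbT leNgt; apply/negP => yy'.
pose D := `|c| + `|c'| + 1.
have D0 : 0 < D by rewrite ltr_wpDl // addr_ge0.
have [n nP] := halving_small e0 eS (divr_gt0 yy' D0).
have := nm_triangle (x n) y y'; rewrite (nm_distC (x n)).
have := yP n; have := y'P n.
have : c * e n <= `|c| * e n by rewrite ler_wpM2r // ler_norm.
have : c' * e n <= `|c'| * e n by rewrite ler_wpM2r // ler_norm.
move: nP; rewrite ltr_pdivlMr // /D; have := e0 n; lra.
Qed.

(** [cauchy_estimate] wants a centre [p] different from [z]. An auxiliary one at distance r / 16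
    from [z] is used, with the ball of radius r / 2 about it inside the given ball. *)
Lemma cauchy_estimate_ball u w z l (r M : R) :
  (forall v, nm (v - w) < r -> derivable u v 1) ->
  (forall v, nm (v - w) < r -> nm (u v) <= M) ->
  nm (z - w) < r / 8 -> cderiv u z l -> nm l <= 8 * M / r.
Proof.
move=> du uM zw ul.
have r0 : 0 < r by have := nm_ge0 (z - w); lra.
have [p pz] := nm_ball_point z (divr_gt0 r0 (ltr0Sn _ 15)).
have sub v : 0 < nm (v - p) < r / 2 -> nm (v - w) < r.
  move=> /andP[_ vp]; have := nm_triangle p v w; have := nm_triangle z p w; lra.
have -> : 8 * M / r = 4 * M / (r / 2) by field; rewrite gt_eqF.
apply: (@cauchy_estimate _ u p z l (r / 2) M) => //.
- by move=> v /sub /du.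
- by move=> v /sub /uM.
- by rewrite nm_distC pz; apply/andP; split; lra.
Qed.

(** Cauchy estimates for [h n.+1 - h n] make the derivatives at [w] converge, and make the
    increments from [w] converge at a rate proportional to |z - w|. The linear approximation of one
    [h n] then passes to [g]. *)
Lemma uniform_limit_derivable (h : nat -> C -> C) g e w (r : R) : 0 < r ->
  (forall n, 0 <= e n) -> (forall n, e n.+1 <= e n / 2) ->
  (forall n z, nm (z - w) < r -> derivable (h n) z 1) ->
  (forall n z, nm (z - w) < r -> nm (h n.+1 z - h n z) <= e n) ->
  (forall n z, nm (z - w) < r -> nm (g z - h n z) <= 4 * e n) ->
  derivable g w 1.
Proof.
move=> r0 e0 eS dh hS gh.
have ww : nm (w - w) < r by rewrite subrr nm0.
have dD n v : nm (v - w) < r -> derivable (fun z => h n.+1 z - h n z) v 1.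
  move=> vr; exact (derivable_funB (dh n.+1 v vr) (dh n v vr)).
have e8 n : 0 <= 8 * e n / r by rewrite divr_ge0 ?mulr_ge0 // ltW.
have e8S n : 8 * e n.+1 / r <= 8 * e n / r / 2.
  by rewrite [leRHS]mulrAC ler_pM2r ?invr_gt0 //; have := eS n; lra.
have [l lP] : exists l : nat -> C, forall n, cderiv (h n) w (l n).
  have /choice [l lP] : forall n, exists l, cderiv (h n) w l.
    by move=> n; apply/cderivP; exact: dh.
  by exists l.
have lS n : nm (l n.+1 - l n) <= 8 * e n / r.
  apply: (cauchy_estimate_ball (dD n) (hS n) (z := w)).
    by rewrite subrr nm0 divr_gt0.
  move=> c c0; have c20 : 0 < c / 2 by rewrite divr_gt0.
  have [d1 d10 d1P] := lP n.+1 _ c20; have [d2 d20 d2P] := lP n _ c20.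
  exists (Num.min d1 d2); first by rewrite lt_min d10.
  move=> v; rewrite lt_min => /andP[/d1P h1 /d2P h2].
  have -> : h n.+1 v - h n v - (h n.+1 w - h n w) - (l n.+1 - l n) * (v - w) =
    (h n.+1 v - h n.+1 w - l n.+1 * (v - w)) - (h n v - h n w - l n * (v - w)).
    by ring.
  by apply: (le_trans (nmB _ _)); have := nm_ge0 (v - w); lra.
have [L LP] := halving_limit e8 e8S lS.
have lipD n z : nm (z - w) < r / 8 ->
    nm (h n.+1 z - h n z - (h n.+1 w - h n w)) <= 8 * e n / r * nm (z - w).
  move=> zr.
  apply: (@segment_lipschitz _ (fun z => h n.+1 z - h n z)).
    exact: derivable_continuous_nm (dD n w ww).
  move=> t /andP[t0 t1]; set v := w + _.
  have vw : nm (v - w) < r / 8.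
    rewrite /v addrC addKr nmM nm_real gtr0_norm //.
    by apply: le_lt_trans zr; rewrite ler_piMl ?nm_ge0.
  have vr : nm (v - w) < r by lra.
  have [m hm] := (cderivP _ v).1 (dD n v vr).
  exists m => //; exact: (cauchy_estimate_ball (dD n) (hS n) vw hm).
have lipg n z : nm (z - w) < r / 8 ->
    nm (g z - g w - (h n z - h n w)) <= 4 * (8 * e n / r * nm (z - w)).
  move=> zr; have zr' : nm (z - w) < r by lra.
  have [|||y yP] := @halving_limit (fun n => h n z - h n w)
      (fun n => 8 * e n / r * nm (z - w)).
  - by move=> m; rewrite mulr_ge0 ?nm_ge0.
  - by move=> m; rewrite [leRHS]mulrAC ler_wpM2r ?nm_ge0.
  - move=> m; apply: le_trans (lipD m z zr).
    rewrite (_ : h m.+1 z - h m.+1 w - _ =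
      h m.+1 z - h m z - (h m.+1 w - h m w)) //; ring.
  rewrite (_ : g z - g w = y) //.
  (* The limit [y] of the increments comes with a rate in |z - w|, whereas [g z - g w] is known to
     be a limit at a uniform rate; equality transfers the better rate to [g]. *)
  apply: (@halving_limit_unique (fun n => h n z - h n w) e _ _ 8
     (4 * (8 / r * nm (z - w)))) => // m.
    have -> : g z - g w - (h m z - h m w) = (g z - h m z) - (g w - h m w) by ring.
    apply: (le_trans (nmB _ _)); have := gh m z zr'; have := gh m w ww; lra.
  by apply: (le_trans (yP m)); rewrite le_eqVlt; apply/orP; left; apply/eqP; ring.
apply: (@cderiv_derivable _ g w L) => c c0.
(* Two of the three errors carry a factor 4, hence c / 12; each of the three is at most a third of
   [c]. *)
have c30 : 0 < c / 12 by rewrite divr_gt0.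
have [n nP] := halving_small e8 e8S c30.
have c20 : 0 < c / 3 by rewrite divr_gt0.
have [d d0 dP] := lP n _ c20.
exists (Num.min d (r / 8)); first by rewrite lt_min d0 divr_gt0.
move=> z; rewrite lt_min => /andP[/dP h1 zr].
have h2 := lipg n z zr.
have h3 : nm ((l n - L) * (z - w)) <= 4 * (8 * e n / r) * nm (z - w).
  by rewrite nmM ler_wpM2r ?nm_ge0 // nm_distC.
have -> : g z - g w - L * (z - w) = (g z - g w - (h n z - h n w)) +
   (h n z - h n w - l n * (z - w)) + (l n - L) * (z - w) by ring.
apply: (le_trans (nmD _ _)).
have := nmD (g z - g w - (h n z - h n w)) (h n z - h n w - l n * (z - w)).
have : 8 * e n / r * nm (z - w) <= c / 12 * nm (z - w).
  by rewrite ler_wpM2r ?nm_ge0 // ltW.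
move: (8 * e n / r) h2 h3 => q h2 h3; lra.
Qed.

Lemma disc_algebra_complete (Om : set C) (h : nat -> C -> C) e :
  (forall w, Om w -> exists2 r : R, 0 < r & forall v, nm (v - w) < r -> Om v) ->
  (forall n, 0 <= e n) -> (forall n, e n.+1 <= e n / 2) ->
  (forall n, disc_algebra Om (h n)) ->
  (forall n z, closure Om z -> nm (h n.+1 z - h n z) <= e n) ->
  exists2 g, disc_algebra Om g &
    forall n z, closure Om z -> nm (g z - h n z) <= 4 * e n.
Proof.
move=> oOm e0 eS Ah hS.
have /choice [g gP] : forall z, exists y, closure Om z ->
    forall n, nm (y - h n z) <= 4 * e n.
  move=> z; case: (pselect (closure Om z)) => [cz|N]; last by exists 0.
  have [y yP] := halving_limit e0 eS (fun n => hS n z cz).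
  by exists y.
exists g; last by move=> n z cz; exact: gP.
split.
  apply/within_continuous_nmP => z cz c c0.
  have c90 : 0 < c / 12 by rewrite divr_gt0.
  have [n nP] := halving_small e0 eS c90.
  have [ch _] := Ah n.
  have c30 : 0 < c / 3 by rewrite divr_gt0.
  have [d d0 dP] := (within_continuous_nmP _ _).1 ch z cz _ c30.
  exists d => // w cw wz.
  have -> : g w - g z = (g w - h n w) + (h n w - h n z) - (g z - h n z) by ring.
  apply: (le_lt_trans (nmB _ _)).
  have := nmD (g w - h n w) (h n w - h n z); have := dP w cw wz.
  have := gP w cw n; have := gP z cz n; lra.
move=> w Omw; have [r r0 rP] := oOm w Omw.
have sub z : nm (z - w) < r -> closure Om z by move=> /rP; exact: subset_closure.
apply: (uniform_limit_derivable r0 e0 eS (h := h)).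
- by move=> n z /rP Omz; have [_ hh] := Ah n; exact: hh.
- by move=> n z /sub; exact: hS.
- by move=> n z /sub cz; exact: gP.
Qed.

End Completeness.

(** * Steep functions on the circle *)

Section SteepFunctions.
Variable R : realType.
Local Notation C := (Cplx R).
Implicit Types (T : C -> R) (v : R -> C).

(** [P] is not assumed monotone in [e], so the local hypothesis covers all small [e] at once;
    compactness then gives a common one. *)
Lemma segment_uniform (a b : R) (P : R -> R -> Prop) :
  (forall x, a <= x <= b -> exists2 d : R, 0 < d &
     forall x', `|x' - x| < d -> forall e, 0 < e < d -> P e x') ->
  exists2 e : R, 0 < e & forall x, a <= x <= b -> P e x.
Proof.
move=> loc.
have /compact_near_coveringP cov := @segment_compact R a b.
have : \forall e \near (0 : R)^'+, `[a, b] `<=` P e.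
  apply: cov => x /=; rewrite in_itv /= => /loc[d d0 dP].
  exists ([set x' | `|x' - x| < d], [set e | 0 < e < d]); last first.
    by move=> [x' e] /= [h1 h2]; exact: dP.
  split=> /=.
    by apply/nbhs_normP; exists d => // y /=; rewrite distrC.
  near=> e; apply/andP; split; near: e; first exact: nbhs_right_gt.
  exact: nbhs_right_lt.
move=> near_e.
near (0 : R)^'+ => e.
have eP : `[a, b] `<=` P e by near: e.
exists e; first by near: e; exact: nbhs_right_gt.
by move=> x xab; apply: eP; rewrite /= in_itv.
Unshelve. all: by end_near. Qed.

(** One natural number bounds both the scale and the slope, so that countably many conditions
    suffice. [T] stands for the real or the imaginary part. *)
Definition steep T v (k : nat) := forall th : R,
  exists2 h, 0 < h < k.+1%:R^-1 & k%:R * h < `|T (v (th + h)) - T (v th)|.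

Lemma steepP T v : (forall k, steep T v k) <->
  forall th, infinite_right_upper_dini (fun y => T (v y)) th.
Proof.
split=> [sv th M d d0|dv k th].
  pose k := maxn (Num.truncn M).+1 (Num.truncn d^-1).+1.
  have Mk : M <= k%:R.
    apply: (@le_trans _ _ (Num.truncn M).+1%:R); first by rewrite ltW // truncnS_gt.
    by rewrite ler_nat leq_maxl.
  have dk : k.+1%:R^-1 <= d.
    rewrite -[leRHS]invrK lef_pV2 ?posrE ?invr_gt0 ?ltr0Sn //.
    apply: (@le_trans _ _ (Num.truncn d^-1).+1%:R).
      by rewrite ltW // truncnS_gt.
    rewrite ler_nat; apply: (@leq_trans k) => //; exact: leq_maxr.
  have [h /andP[h0 hk] steep_h] := sv k th.
  exists (th + h); split; first by rewrite ltrDl h0 ltrD2l (lt_le_trans hk).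
  rewrite [th + h - th](_ : _ = h); last by rewrite addrC addKr.
  rewrite normrM normfV (gtr0_norm h0) ltr_pdivlMr //.
  by apply: le_lt_trans steep_h; rewrite ler_pM2r.
have [|y [/andP[y1 y2] My]] := dv th k%:R k.+1%:R^-1; first by rewrite invr_gt0.
exists (y - th); first by rewrite subr_gt0 y1 /= ltrBlDl.
rewrite [th + (y - th)](_ : _ = y); last by rewrite addrC subrK.
have yth : 0 < y - th by rewrite subr_gt0.
by rewrite normrM normfV (gtr0_norm yth) ltr_pdivlMr in My.
Qed.

Definition eps_continuous v := forall x : R, forall e : R, 0 < e ->
  exists2 d : R, 0 < d & forall y, `|y - x| < d -> nm (v y - v x) < e.

(** Factoring through the circle encodes periodicity, which reduces statements about all angles to a
    compact interval. *)
Definition circle_fun v := exists q : C -> C, forall y, v y = q (expi y).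

Lemma circle_fun_unif v : circle_fun v -> eps_continuous v ->
  forall c : R, 0 < c -> exists2 d : R, 0 < d &
    forall th h, 0 <= h < d -> nm (v (th + h) - v th) < c.
Proof.
move=> [q qv] cv c c0.
pose P (e th : R) := forall h, 0 <= h < e -> nm (v (th + h) - v th) < c.
have [x _|d d0 dP] := @segment_uniform (- pi) pi P.
  have c20 : 0 < c / 2 by rewrite divr_gt0.
  have [d d0 dP] := cv x _ c20.
  exists (d / 2); first by rewrite divr_gt0.
  move=> x' xx' e /andP[e0 ed] h /andP[h0 he].
  have h1 : nm (v x' - v x) < c / 2 by apply: dP; lra.
  have h2 : nm (v (x' + h) - v x) < c / 2.
    apply: dP; rewrite (_ : x' + h - x = (x' - x) + h); last by ring.
    by apply: (le_lt_trans (ler_normD _ _)); rewrite (ger0_norm h0); lra.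
  by have := nm_triangle (v x) (v (x' + h)) (v x'); rewrite (nm_distC (v x) (v x')); lra.
exists d => // th h hd; have [t tpi tE] := expi_reduce th.
have := dP t tpi h hd; rewrite !qv tE.
by have := tE 0; rewrite !addr0 => ->.
Qed.

Lemma steep_open T v k : (forall z w, T (z - w) = T z - T w) ->
  (forall z, `|T z| <= nm z) -> circle_fun v -> eps_continuous v ->
  steep T v k -> exists2 e : R, 0 < e & forall v',
    (forall y, nm (v y - v' y) < e) -> steep T v' k.
Proof.
move=> TB Tn [q qv] cv sv.
(* The margin [2 * e] pays for changing [v] by less than [e] at both [th] and [th + h]. *)
pose P (e th : R) := exists2 h, 0 < h < k.+1%:R^-1 &
   k%:R * h + 2 * e < `|T (v (th + h)) - T (v th)|.
have [x _|e e0 eP] := @segment_uniform (- pi) pi P.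
  have [h hk hs] := sv x.
  (* A quarter of the available margin: one for each of the two values moved from [x] to [x'], and
     two for [2 * e]. *)
  pose c := (`|T (v (x + h)) - T (v x)| - k%:R * h) / 4.
  have c0 : 0 < c by rewrite divr_gt0 // subr_gt0.
  have [d1 d10 d1P] := cv x c c0; have [d2 d20 d2P] := cv (x + h) c c0.
  exists (Num.min c (Num.min d1 d2)); first by rewrite !lt_min c0 d10.
  move=> x'; rewrite !lt_min => /and3P[_ x1 x2] e /andP[e0].
  rewrite lt_min => /andP[ec _].
  exists h => //.
  have h1 : `|T (v x' ) - T (v x)| < c.
    by rewrite -TB; apply: (le_lt_trans (Tn _)); exact: d1P.
  have h2 : `|T (v (x' + h)) - T (v (x + h))| < c.
    rewrite -TB; apply: (le_lt_trans (Tn _)); apply: d2P.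
    by rewrite (_ : x' + h - (x + h) = x' - x) //; ring.
  have := ler_distD (T (v (x' + h))) (T (v (x + h))) (T (v x)).
  have := ler_distD (T (v x')) (T (v (x' + h))) (T (v x)).
  rewrite (distrC (T (v (x + h))) (T (v (x' + h)))).
  have : 4 * c = `|T (v (x + h)) - T (v x)| - k%:R * h by rewrite /c; field.
  lra.
exists e => // v' vv' th; have [t tpi tE] := expi_reduce th.
have [h hk] := eP t tpi; rewrite !qv tE.
have := tE 0; rewrite !addr0 => -> hs; rewrite -!qv in hs.
exists h => //.
have h1 : `|T (v (th + h)) - T (v' (th + h))| < e.
  by rewrite -TB; apply: (le_lt_trans (Tn _)).
have h2 : `|T (v' th) - T (v th)| < e.
  by rewrite -TB; apply: (le_lt_trans (Tn _)); rewrite nm_distC.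
have := ler_distD (T (v' (th + h))) (T (v (th + h))) (T (v th)).
have := ler_distD (T (v' th)) (T (v' (th + h))) (T (v th)).
lra.
Qed.

Definition half_turn_gap T := forall x : R, exists2 h : R, 0 < h <= pi &
  4^-1 <= `|T (expi (x + h)) - T (expi x)|.

(** [- a] and [- b] are the values of a coordinate [a] after a half and a quarter turn. If both
    changes were below 1/4, then |a| < 1/8 and |b| < 3/8, too small for a^2 + b^2 = 1. *)
Lemma unit_pair_gap (a b : R) : a ^+ 2 + b ^+ 2 = 1 ->
  4^-1 <= `|- a - a| \/ 4^-1 <= `|- b - a|.
Proof.
move=> ab; case: (leP 4^-1 `|- a - a|) => h1; first by left.
right; rewrite leNgt; apply/negP => h2.
move: h1 h2; rewrite !ltr_norml => /andP[h1 h1'] /andP[h2 h2']; nra.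
Qed.

Lemma half_turn_gap_Re : half_turn_gap (@complex.Re R).
Proof.
move=> x; have pi0 := pi_gt0 R.
have [h|h] := unit_pair_gap (cos2Dsin2 x).
  exists pi; first by rewrite pi0 lexx.
  by rewrite /= cosDpi.
exists (pi / 2); first by apply/andP; split; lra.
by rewrite /= cosDpihalf.
Qed.

Lemma half_turn_gap_Im : half_turn_gap (@complex.Im R).
Proof.
move=> x; have pi0 := pi_gt0 R.
have [|h|h] := @unit_pair_gap (sin x) (- cos x).
- by rewrite sqrrN addrC cos2Dsin2.
- exists pi; first by rewrite pi0 lexx.
  by rewrite /= sinDpi.
- exists (pi / 2); first by apply/andP; split; lra.
  by rewrite /= sinDpihalf -[cos x]opprK.
Qed.

(** The step is h / n, with [h] the gap at the angle n th. The added term jumps by at least c / 4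
    and [v] takes back less than c / 16; the remaining jump exceeds c / 16, which is more than k h /
    n. *)
Lemma steep_perturb T v k (c : R) n : 0 < c -> (0 < n)%N ->
  (forall z w, T (z + w) = T z + T w) ->
  (forall z w, T (z - w) = T z - T w) ->
  (forall (a : R) (z : C), T ((a%:C)%C * z) = a * T z) ->
  (forall z, `|T z| <= nm z) -> half_turn_gap T ->
  (forall th h : R, 0 <= h <= pi / n%:R -> nm (v (th + h) - v th) < c / 16) ->
  (pi : R) / n%:R < k.+1%:R^-1 -> k%:R * (pi / n%:R) < c / 16 ->
  steep T (fun y : R => v y + (c%:C)%C * (expi y : C) ^+ n) k.
Proof.
move=> c0 n0 TD TB TZ Tn Tgap vc nk kn th.
have nR : (0 : R) < n%:R by rewrite ltr0n.
have [h /andP[h0 hpi] hs] := Tgap (n%:R * th).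
have hn : 0 < h / n%:R <= pi / n%:R by rewrite divr_gt0 //= ler_pM2r ?invr_gt0.
have /andP[hn0 hn1] := hn.
exists (h / n%:R); first by rewrite hn0 (le_lt_trans hn1).
have kh : k%:R * (h / n%:R) < c / 16.
  by apply: le_lt_trans kn; rewrite ler_wpM2l.
apply: (lt_trans kh).
rewrite !TD !TZ !expiX mulrDr [n%:R * (h / n%:R)](_ : _ = h); last first.
  by rewrite mulrC divfK // gt_eqF.
have h1 : `|T (v th) - T (v (th + h / n%:R))| < c / 16.
  rewrite -TB; apply: (le_lt_trans (Tn _)); rewrite nm_distC.
  by apply: vc; rewrite ltW.
have h2 : c / 4 <= `|c * T (expi (n%:R * th + h)) - c * T (expi (n%:R * th))|.
  by rewrite -mulrBr normrM (gtr0_norm c0) ler_pM2l.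
move: (T (v (th + h / n%:R))) (T (v th)) (c * T (expi (n%:R * th + h)))
  (c * T (expi (n%:R * th))) h1 h2 => p q a b h1 h2.
have := ler_normD (p + a - (q + b)) (q - p).
have -> : p + a - (q + b) + (q - p) = a - b by ring.
lra.
Qed.

End SteepFunctions.

(** * Genericity *)

Section GenericFunctions.
Variable R : realType.
Local Notation C := (Cplx R).
Variables (Om : set C) (phi psi : C -> C).
Hypothesis Om_open : forall w, Om w ->
  exists2 r : R, 0 < r & forall v, nm (v - w) < r -> Om v.
Hypothesis phi_cont : {within @closed_disc R, continuous phi}.
Hypothesis psi_cont : {within closure Om, continuous psi}.
Hypothesis phiP : forall z, closed_disc z -> closure Om (phi z) /\ psi (phi z) = z.
Hypothesis psiP : forall w, closure Om w -> closed_disc (psi w) /\ phi (psi w) = w.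
Hypothesis psi_hol : holomorphic_on psi Om.

Definition steep_set (k : nat) : set (C -> C) := [set f |
  steep (@complex.Re R) (fun y => f (phi (expi y))) k /\
  steep (@complex.Im R) (fun y => f (phi (expi y))) k].

Lemma comp_phi_continuous (f : C -> C) : {within closure Om, continuous f} ->
  {within @closed_disc R, continuous (f \o phi)}.
Proof.
move=> cf; apply/within_continuous_nmP => z zD e e0.
have [cz _] := phiP zD.
have [d d0 dP] := (within_continuous_nmP _ _).1 cf (phi z) cz e e0.
have [d' d'0 d'P] := (within_continuous_nmP _ _).1 phi_cont z zD d d0.
exists d' => // w wD wz; apply: dP; last exact: d'P.
by have [] := phiP wD.
Qed.

Lemma comp_phi_expi_continuous (f : C -> C) : {within closure Om, continuous f} ->
  eps_continuous (fun y : R => f (phi (expi y))).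
Proof.
move=> /comp_phi_continuous cf x e e0.
have [d d0 dP] := (within_continuous_nmP _ _).1 cf (expi x) (@closed_disc_expi _ x) e e0.
have : nbhs (expi x : C) [set w : C | nm (w - expi x) < d].
  by apply/nbhs_nmP; exists d.
move=> /(@expi_continuous R x); rewrite nbhs_simpl /= => /nbhs_normP [d' /= d'0 d'P].
exists d' => // y yx; apply: dP; first exact: closed_disc_expi.
by apply: d'P; rewrite /= distrC.
Qed.

Lemma steep_set_open k : open_in_A Om (steep_set k).
Proof.
move=> f [cf _] [sR sI].
have cv := comp_phi_expi_continuous cf.
have cfun : circle_fun (fun y : R => f (phi (expi y))) by exists (f \o phi).
have [e1 e10 e1P] := steep_open (@ReB R) (@nm_Re R) cfun cv sR.
have [e2 e20 e2P] := steep_open (@ImB R) (@nm_Im R) cfun cv sI.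
exists (Num.min e1 e2); first by rewrite lt_min e10.
move=> g _ fg.
have fg' y : nm (f (phi (expi y)) - g (phi (expi y))) < Num.min e1 e2.
  by rewrite -normC_lt; apply: fg; have [] := phiP (@closed_disc_expi _ y).
split; [apply: e1P => y|apply: e2P => y]; have := fg' y; rewrite lt_min;
  by case/andP.
Qed.

Lemma nm_psi_le1 z : closure Om z -> nm (psi z) <= 1.
Proof. by move=> /psiP[+ _]; rewrite /closed_disc /= nmE -lecR. Qed.

Lemma disc_algebra_perturb f (c : R) n : disc_algebra Om f ->
  disc_algebra Om (fun z => f z + (c%:C)%C * psi z ^+ n).
Proof.
move=> [cf hf]; split.
  apply/within_continuous_nmP => z cz e e0.
  have e20 : 0 < e / 2 by rewrite divr_gt0.
  have [d1 d10 d1P] := (within_continuous_nmP _ _).1 cf z cz _ e20.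
  have dX := derivable_funM (@derivable_fun_cst _ ((c%:C)%C) (psi z))
    (derivable_funX (n := n) (@derivable_fun_id _ (psi z))).
  have [d2 d20 d2P] := derivable_continuous_nm dX e20.
  have [d3 d30 d3P] := (within_continuous_nmP _ _).1 psi_cont z cz _ d20.
  exists (Num.min d1 d3); first by rewrite lt_min d10.
  move=> w cw; rewrite lt_min => /andP[/(d1P w cw) h1 /(d3P w cw)/d2P h2].
  have -> : f w + (c%:C)%C * psi w ^+ n - (f z + (c%:C)%C * psi z ^+ n) =
    (f w - f z) + ((c%:C)%C * psi w ^+ n - (c%:C)%C * psi z ^+ n) by ring.
  by apply: (le_lt_trans (nmD _ _)); lra.
move=> z Omz.
have dX := derivable_funM (@derivable_fun_cst _ ((c%:C)%C) z)
  (@derivable_funX _ psi n z (psi_hol Omz)).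
exact (derivable_funD (hf z Omz) dX).
Qed.

Lemma steep_set_dense k f (c : R) : disc_algebra Om f -> 0 < c ->
  exists2 g, disc_algebra Om g /\ steep_set k g &
    forall z, closure Om z -> nm (g z - f z) <= c.
Proof.
move=> Af c0; have [cf _] := Af.
have cv := comp_phi_expi_continuous cf.
have cfun : circle_fun (fun y : R => f (phi (expi y))) by exists (f \o phi).
have c160 : 0 < c / 16 by rewrite divr_gt0.
have [d d0 dP] := circle_fun_unif cfun cv c160.
have pi0 := pi_gt0 R.
have [n n0 [n1 n2 n3]] : exists2 n, (0 < n)%N & [/\ (pi : R) / n%:R < d,
    (pi : R) / n%:R < k.+1%:R^-1 & k%:R * (pi / n%:R) < c / 16].
  (* The three entries are the three requirements on pi / n; dividing by k + 1 also covers k = 0. *)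
  pose t := Num.min d (Num.min k.+1%:R^-1 (c / 16 / k.+1%:R)).
  have t0 : 0 < t by rewrite !lt_min d0 invr_gt0 ltr0Sn divr_gt0.
  exists (Num.truncn (pi / t)).+1 => //.
  set n := _.+1.
  have nR : (0 : R) < n%:R by rewrite ltr0n.
  have : pi / n%:R < t by rewrite ltr_pdivrMr // mulrC -ltr_pdivrMr // truncnS_gt.
  rewrite !lt_min => /and3P[h1 h2 h3]; split=> //.
  move: h3; rewrite ltr_pdivlMr ?ltr0Sn // mulrC; apply: le_lt_trans.
  by rewrite ler_pM2r ?divr_gt0 // ler_nat.
pose g z := f z + (c%:C)%C * psi z ^+ n.
exists g; last first.
  move=> z cz; rewrite /g addrC addKr nmM nm_real (gtr0_norm c0) nmX.
  by rewrite ler_piMr ?(ltW c0) // exprn_ile1 ?nm_ge0 // nm_psi_le1.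
split; first exact: disc_algebra_perturb.
have gE : (fun y : R => g (phi (expi y))) =
    (fun y : R => f (phi (expi y)) + (c%:C)%C * (expi y : C) ^+ n).
  apply/funext => y; rewrite /g.
  by have [_ ->] := phiP (@closed_disc_expi _ y).
have vc (th h : R) : 0 <= h <= pi / n%:R ->
    nm (f (phi (expi (th + h))) - f (phi (expi th))) < c / 16.
  by move=> /andP[h0 hn]; apply: dP; rewrite h0 (le_lt_trans hn).
rewrite /steep_set /= gE; split.
- apply: steep_perturb => //.
  + by case=> a b [].
  + exact: ReB.
  + by move=> a [x y] /=; rewrite mul0r subr0.
  + exact: nm_Re.
  + exact: half_turn_gap_Re.
- apply: steep_perturb => //.
  + by case=> a b [].
  + exact: ImB.
  + by move=> a [x y] /=; rewrite mul0r addr0.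
  + exact: nm_Im.
  + exact: half_turn_gap_Im.
Qed.

Lemma classZ_steep f : disc_algebra Om f ->
  classZ (f \o phi) <-> forall k, steep_set k f.
Proof.
move=> [cf _]; split=> [[_ Z] k|sf].
  by split; [apply/steepP: k => th|apply/steepP: k => th]; have [] := Z th.
split=> [|th]; last first.
  have /steepP sR : forall k, steep (@complex.Re R) (fun y => f (phi (expi y))) k.
    by move=> k; have [] := sf k.
  have /steepP sI : forall k, steep (@complex.Im R) (fun y => f (phi (expi y))) k.
    by move=> k; have [] := sf k.
  by split; [exact: sR|exact: sI].
apply: (@continuous_subspaceW _ _ _ (@closed_disc R)); last exact: comp_phi_continuous.
by move=> z; rewrite /unit_circle /closed_disc /= => ->.
Qed.

(* Baire's argument, run by hand: each approximant enters the next open set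
   while staying within a fraction of the previous radii. *)
Lemma steep_sets_dense f (c : R) : disc_algebra Om f -> 0 < c ->
  exists2 g, disc_algebra Om g /\ (forall k, steep_set k g) &
    forall z, closure Om z -> nm (f z - g z) < c.
Proof.
move=> Af c0.
(* A state holds the index, the current approximant and the radius still allowed. The factor 4
   matches the distance to the limit given by [disc_algebra_complete]. *)
pose Q (s s' : nat * (C -> C) * R) :=
  let: (k, f, e) := s in let: (k', g, e') := s' in
  disc_algebra Om f -> 0 < e ->
  [/\ k' = k.+1, disc_algebra Om g, 0 < e', e' <= e / 2 &
     (forall z, closure Om z -> nm (g z - f z) <= e) /\
     (forall g', disc_algebra Om g' ->
       (forall z, closure Om z -> nm (g' z - g z) <= 4 * e') -> steep_set k g')].
have /choice [step stepP] : forall s, exists s', Q s s'.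
  move=> [[k h] e].
  case: (pselect (disc_algebra Om h /\ 0 < e)) => [[Ah e0]|N]; last first.
    by exists (k, h, e) => Ah e0; case: N.
  have [g [Ag sg] gh] := steep_set_dense k Ah e0.
  have [r r0 rP] := steep_set_open Ag sg.
  (* With r / 8, functions within four radii of [g] are within r / 2, strictly inside the
     neighbourhood of radius [r] in the open set. *)
  exists (k.+1, g, Num.min (e / 2) (r / 8)) => _ _.
  split=> //; first by rewrite lt_min !divr_gt0.
    by rewrite ge_min lexx.
  split=> // g' Ag' g'g; apply: rP => // z cz.
  rewrite normC_lt nm_distC; apply: (le_lt_trans (g'g z cz)).
  have : Num.min (e / 2) (r / 8) <= r / 8 by rewrite ge_min lexx orbT.
  lra.
(* Starting radius c / 8: the limit is within 4 (c / 8) < c of [f]. *)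
pose s n := iter n step (0%N, f, c / 8).
pose h n := (s n).1.2; pose e n := (s n).2.
have sE n : s n = ((s n).1.1, h n, e n) by rewrite /h /e; case: (s n) => [[]].
have inv n : [/\ (s n).1.1 = n, disc_algebra Om (h n) & 0 < e n].
  elim: n => [|n [sn Ahn en]]; first by rewrite /h /e /s /=; split=> //; rewrite divr_gt0.
  have := stepP (s n); rewrite -[step _]/(s n.+1) sE (sE n.+1) /Q sn.
  by move=> /(_ Ahn en) [-> ? ?].
have next n : [/\ e n.+1 <= e n / 2,
     (forall z, closure Om z -> nm (h n.+1 z - h n z) <= e n) &
     (forall g', disc_algebra Om g' ->
       (forall z, closure Om z -> nm (g' z - h n.+1 z) <= 4 * e n.+1) ->
       steep_set n g')].
  have [sn Ahn en] := inv n.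
  have := stepP (s n); rewrite -[step _]/(s n.+1) sE (sE n.+1) /Q sn.
  by move=> /(_ Ahn en) [_ _ _ ? []].
have e_ge0 n : 0 <= e n by have [_ _ /ltW] := inv n.
have eS n : e n.+1 <= e n / 2 by have [] := next n.
have Ah n : disc_algebra Om (h n) by have [] := inv n.
have hS n z : closure Om z -> nm (h n.+1 z - h n z) <= e n.
  by have [_ + _] := next n; apply.
have [g Ag gh] := disc_algebra_complete Om_open e_ge0 eS Ah hS.
exists g.
  (* Membership in the k-th set was secured when [h k.+1] was chosen, so the limit is compared with
     that approximant. *)
  split=> // k; have [_ _] := next k; apply=> // z cz; exact: gh.
move=> z cz; rewrite nm_distC; have := gh 0%N z cz.
by rewrite /h /e /s /=; lra.
Qed.

End GenericFunctions.

Theorem theorem3p1 (R : realType) (Om : set (Cplx R)) (phi : Cplx R -> Cplx R) :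
  jordan_domain Om ->
  riemann_mapping Om phi ->
  let S := [set f | disc_algebra Om f /\ classZ (f \o phi)] in
  Gdelta_in_A Om S /\ dense_in_A Om S.
Proof.
move=> jOm [cphi [[psi [cpsi [phiP psiP]]] [phiE hphi]]] S.
have oOm w (Omw : Om w) := jordan_domain_open jOm Omw.
have hpsi := inverse_holomorphic oOm cpsi phiP psiP phiE hphi.
have subA : S `<=` disc_algebra Om by move=> f [].
have ZP := classZ_steep cphi phiP.
split; split=> //.
  exists (steep_set phi); split; first exact: (steep_set_open cphi phiP).
  apply/seteqP; split=> [f [Af /(ZP f Af) sf]|f [Af sf]].
    by split; [exact: Af|move=> k _; exact: sf].
  by split; [exact: Af|apply/(ZP f Af) => k; exact: (sf k I)].
move=> f Af e e0.
have [g [Ag sg] fg] := steep_sets_dense oOm cphi cpsi phiP psiP hpsi Af e0.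
exists g; first by split; [exact: Ag|exact/(ZP g Ag)].
by move=> z cz; rewrite normC_lt; exact: fg.
Qed.
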